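(* For every $C>0$ there is a constant $K=K(C)>0$ such that the following holds for every $N\ge 3$. Let $X_1,\dots,X_N$ be independent real mean zero random variables with $|X_i|\le C$ and $\mathbb{E}[|X_i|^2]=1$ for all $i$, and let $a_1,\dots,a_N$ be real numbers. Then $$\left(\mathbb{E}\left[\left\|\{a_iX_i\}_{i=1}^{N}\right\|_{V^2}^2\right]\right)^{1/2}\le K\sqrt{\ln\ln(N)}\left(\sum_{i=1}^{N}a_i^2\right)^{1/2}.$$ In particular, the $L^2$ norm of the $V^2$ operator for the Rademacher system grows like $\sqrt{\ln\ln(N)}$: there are absolute constants $0<c<c'$ such that for all $N\ge 3$, $$c\sqrt{\ln\ln(N)}\le\sup_{a}\frac{\left(\int_{\mathbb{T}}\left\|\{a_nr_n(x)\}_{n=1}^{N}\right\|_{V^2}^2dx\right)^{1/2}}{\left(\sum_{n=1}^{N}a_n^2\right)^{1/2}}\le c'\sqrt{\ln\ln(N)},$$ where the supremum is over all nonzero real $(a_1,\dots,a_N)$ and $\{r_n\}$ is the Rademacher system.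
   Context: $\mathbb{T}=[0,1]$ with Lebesgue measure. For a finite sequence $b=(b_n)_{n=1}^{N}$ of numbers, $\|b\|_{V^2}=\sup_{\mathcal{P}}\left(\sum_{I\in\mathcal{P}}\left|\sum_{n\in I}b_n\right|^2\right)^{1/2}$, the supremum being over all partitions $\mathcal{P}$ of $\{1,\dots,N\}$ into disjoint subintervals. The Rademacher system is $r_n(x)=\operatorname{sign}\sin(2^n\pi x)$, $n\ge1$, on $\mathbb{T}$. *)

(* Defs.v *)
From HB Require Import structures.
From mathcomp Require Export all_boot all_order all_algebra.
From mathcomp Require Export all_classical all_reals all_analysis.

Set Implicit Arguments.
Unset Strict Implicit.
Unset Printing Implicit Defensive.

Import Order.TTheory GRing.Theory Num.Theory.
Local Open Scope classical_set_scope.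
Local Open Scope ring_scope.

Definition is_subinterval (N : nat) (A : {set 'I_N}) : bool :=
  [exists i : 'I_N, exists j : 'I_N, A == [set k : 'I_N | (i <= k <= j)%N]%SET].

Definition interval_partition (N : nat) (Q : {set {set 'I_N}}) : bool :=
  finset.partition Q [set: 'I_N]%SET && [forall A in Q, is_subinterval A].

(* The terms b_1, ..., b_N are stored at the indices 0, ..., N - 1 of 'I_N.
   The supremum is over a finite set of reals, nonempty because the partition
   into singletons is admissible. *)
Definition V2norm (R : realType) (N : nat) (b : 'I_N -> R) : R :=
  sup [set Num.sqrt (\sum_(A in Q) `|\sum_(n in A) b n| ^+ 2)
      | Q in [set Q : {set {set 'I_N}} | interval_partition Q]].

Definition independent_RVs (R : realType) (d : measure_display)
    (T : measurableType d) (P : probability T R) (I : finType)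
    (X : I -> {RV P >-> R}) : Prop :=
  forall (J : {set I}) (B : I -> set R), (forall i, measurable (B i)) ->
    P (\bigcap_(i in [set` J]) (X i @^-1` B i)) =
    (\prod_(i in J) P (X i @^-1` B i))%E.

Definition rademacher (R : realType) (n : nat) (x : R) : R :=
  Num.sg (sin (2 ^+ n * pi * x)).

(* The term n : 'I_N carries the Rademacher function r_{n+1}, since the
   system starts at index 1. *)
Definition rademacher_V2_L2 (R : realType) (N : nat) (a : 'I_N -> R) : \bar R :=
  sqrte (\int[@lebesgue_measure R]_(x in `[0%R, 1%R])
    (V2norm (fun n : 'I_N => a n * rademacher n.+1 x) ^+ 2)%R%:E)%E.

(* Main.v *)
Require Import Defs.
From HB Require Import structures.
From mathcomp Require Import all_boot all_order all_algebra.
From mathcomp Require Import all_classical all_reals all_analysis.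
From mathcomp Require Import measurable_realfun.
From mathcomp Require Import ring lra zify.

Set Implicit Arguments.
Unset Strict Implicit.
Unset Printing Implicit Defensive.

Import Order.TTheory GRing.Theory Num.Theory.
Local Open Scope classical_set_scope.
Local Open Scope ring_scope.

(** Upper bound. Put [w i = a i ^ 2 + (sum of the a j ^ 2) / N]. For an interval
    [A] and a point [i] of [A], split the sum over [A] at [i] into a piece
    running to the right of [i] and a piece running to its left. If, at every
    [i], the square of each one-sided sum is at most its total [w]-weight times
    [D i], then averaging over [i] in [A] with weights [w] bounds the squared
    sum over [A] by the sum over [A] of [2 * w i * (Dr i + Dl i)]; summing over
    a partition, the squared V^2 norm is at most a [w]-weighted sum of the
    one-sided maximal functions [Dr i], [Dl i] ([V2norm_sq_le_maximal]). It
    remains to show that each has expectation O(ln ln N). The term added in [w]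
    keeps the weights of the windows between [w(total) / 2N] and [w(total)], so
    that only O(ln N) dyadic scales occur. At one scale the maximal partial
    sums have a bounded exponential moment of their square
    ([psum_sq_exp_moment], [doob_exp_sq]), and a maximum of O(ln N) such
    variables has expectation O(ln ln N) ([prefix_domination]). The only use of
    independence is that a bounded function of some of the variables is
    orthogonal to every other, centred, one ([adapted_mul0]), which follows
    from the pi-lambda theorem and Fubini's theorem.

    Lower bound. Integrals over [0,1] of functions of the first [m] Rademacher
    functions are averages over sign sequences ([rademacher_integral01]). Take
    [a n = 1] for the first [2 ^ K] indices. Call a dyadic block of length
    [2 ^ k] good if its sum [S] has [4 * S ^ 2 >= 2 ^ j * 2 ^ k]. By a
    Paley-Zygmund argument on [2 ^ j] equal sub-blocks, a block is good with
    probability at least [10 ^ -(2 ^ j)] ([deviation_prob]). With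
    [K = j + 10 ^ (2 ^ j)], so many scales are available that, on average, at
    least half of the indices lie in a dyadic interval one of whose halves is
    good ([uncovered_avg_half]). The maximal intervals of this kind are
    disjoint and their halves are the blocks of a partition
    ([covering_blocks]); the expected sum of squares is at least
    [2 ^ j * 2 ^ K / 16], and [2 ^ j] is comparable to [ln ln (2 ^ K)]. *)

(** * Bounded random variables and their expectations *)

(** Measurable functions with a uniform bound: the class in which all
    expectations of the upper bound are taken, so that integrability is
    automatic. *)
Definition bounded_rv (R : realType) (d : measure_display)
    (T : measurableType d) (f : T -> R) :=
  measurable_fun setT f /\ exists M : R, forall t, `|f t| <= M.

Section bounded_rv_theory.
Context (R : realType) (d : measure_display) (T : measurableType d)
  (P : probability T R).
Implicit Types f g : T -> R.

Lemma bounded_rv_integrable f : bounded_rv f -> P.-integrable setT (EFin \o f).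
Proof.
move=> [mf [M fM]]; apply: measurable_bounded_integrable => //.
  by rewrite -ge0_fin_numE//; exact: fin_num_measure.
exists M; split; first exact: num_real.
by move=> x Mx t _; apply: le_trans (fM t) (ltW Mx).
Qed.

Lemma bounded_rvD f g : bounded_rv f -> bounded_rv g -> bounded_rv (fun t => f t + g t).
Proof.
move=> [mf [M fM]] [mg [N gN]]; split; first exact: measurable_funD.
by exists (M + N) => t; apply: le_trans (ler_normD _ _) (lerD _ _).
Qed.

Lemma bounded_rvM f g : bounded_rv f -> bounded_rv g -> bounded_rv (fun t => f t * g t).
Proof.
move=> [mf [M fM]] [mg [N gN]]; split; first exact: measurable_funM.
by exists (M * N) => t; rewrite normrM ler_pM.
Qed.

Lemma bounded_rv_cst (c : R) : bounded_rv (fun _ : T => c).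
Proof. by split; [exact: measurable_cst|exists `|c|]. Qed.

Lemma bounded_rvZ (c : R) f : bounded_rv f -> bounded_rv (fun t => c * f t).
Proof. exact/bounded_rvM/bounded_rv_cst. Qed.

Lemma bounded_rvB f g : bounded_rv f -> bounded_rv g -> bounded_rv (fun t => f t - g t).
Proof.
move=> bf bg.
have -> : (fun t => f t - g t) = (fun t => f t + -1 * g t).
  by apply/funext => t; rewrite mulN1r.
exact/bounded_rvD/bounded_rvZ.
Qed.

Lemma bounded_rvX f n : bounded_rv f -> bounded_rv (fun t => f t ^+ n).
Proof.
move=> bf; elim: n => [|n IH]; first exact: bounded_rv_cst.
under eq_fun do rewrite exprS.
exact: bounded_rvM.
Qed.

Lemma bounded_rv_sum (I : Type) (s : seq I) (F : I -> T -> R) :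
  (forall i, bounded_rv (F i)) -> bounded_rv (fun t => \sum_(i <- s) F i t).
Proof.
move=> bF; elim: s => [|i s IH].
  by under eq_fun do rewrite big_nil; exact: bounded_rv_cst.
by under eq_fun do rewrite big_cons; exact: bounded_rvD.
Qed.

Lemma bounded_rv_max f g : bounded_rv f -> bounded_rv g ->
  bounded_rv (fun t => Num.max (f t) (g t)).
Proof.
move=> [mf [M fM]] [mg [N gN]]; split; first exact: measurable_maxr.
exists (Num.max M N) => t; rewrite le_max.
by rewrite /Num.max; case: ifPn => _; rewrite (fM, gN) ?orbT.
Qed.

Lemma bounded_rv_expR f : bounded_rv f -> bounded_rv (fun t => expR (f t)).
Proof.
move=> [mf [M fM]]; split; first exact: measurableT_comp.
exists (expR M) => t; rewrite ger0_norm ?expR_ge0// ler_expR.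
exact: le_trans (ler_norm _) (fM t).
Qed.

Lemma RexpD f g : bounded_rv f -> bounded_rv g ->
  \int[P]_t (f t + g t) = \int[P]_t f t + \int[P]_t g t.
Proof. by move=> bf bg; rewrite RintegralD//; exact: bounded_rv_integrable. Qed.

Lemma RexpB f g : bounded_rv f -> bounded_rv g ->
  \int[P]_t (f t - g t) = \int[P]_t f t - \int[P]_t g t.
Proof. by move=> bf bg; rewrite RintegralB//; exact: bounded_rv_integrable. Qed.

Lemma RexpZ (c : R) f : bounded_rv f ->
  \int[P]_t (c * f t) = c * \int[P]_t f t.
Proof. by move=> bf; rewrite RintegralZl//; exact: bounded_rv_integrable. Qed.

Lemma Rexp_cst (c : R) : \int[P]_t c = c.
Proof. by rewrite Rintegral_cst// [X in fine X]probability_setT mulr1. Qed.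

Lemma Rexp_le f g : bounded_rv f -> bounded_rv g -> (forall t, f t <= g t) ->
  \int[P]_t f t <= \int[P]_t g t.
Proof.
by move=> bf bg fg; apply: le_Rintegral => //; exact: bounded_rv_integrable.
Qed.

Lemma Rexp_sum (I : Type) (s : seq I) (F : I -> T -> R) :
  (forall i, bounded_rv (F i)) ->
  \int[P]_t (\sum_(i <- s) F i t) = \sum_(i <- s) \int[P]_t F i t.
Proof.
move=> bF; elim: s => [|i s IH].
  by under eq_Rintegral do rewrite big_nil; rewrite Rexp_cst big_nil.
under eq_Rintegral do rewrite big_cons.
by rewrite RexpD// ?IH ?big_cons//; exact: bounded_rv_sum.
Qed.

Lemma EFin_Rexp f : bounded_rv f -> (\int[P]_t f t)%:E = (\int[P]_t (f t)%:E)%E.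
Proof.
move=> bf; rewrite /Rintegral fineK//.
exact: (integrable_fin_num measurableT (bounded_rv_integrable bf)).
Qed.

(** Independence of [f] and [g] identifies the law of the pair with a product
    measure; the integral of the product then factors by Fubini's theorem. *)
Lemma indep_Rexp_mul0 f g : bounded_rv f -> bounded_rv g ->
  (forall A B, measurable A -> measurable B ->
    P (f @^-1` A `&` g @^-1` B) = (P (f @^-1` A) * P (g @^-1` B))%E) ->
  \int[P]_t g t = 0 -> \int[P]_t (f t * g t) = 0.
Proof.
move=> bf bg fg g0.
have mf := bf.1; have mg := bg.1.
pose F : {RV P >-> R} := MeasurableFun.Pack (MeasurableFun.Class (isMeasurableFun.Build _ _ _ _ _ mf)).
pose G : {RV P >-> R} := MeasurableFun.Pack (MeasurableFun.Class (isMeasurableFun.Build _ _ _ _ _ mg)).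
have mh : measurable_fun setT (fun t => (f t, g t)) by exact: measurable_fun_pair.
pose H : {mfun T >-> (R * R)%type} := MeasurableFun.Pack (MeasurableFun.Class (isMeasurableFun.Build _ _ _ _ _ mh)).
pose m1 := distribution P F; pose m2 := distribution P G.
pose m := distribution P H.
have rect B C : measurable B -> measurable C ->
    m (B `*` C) = (m1 B * m2 C)%E.
  by move=> mB mC; exact: (fg B C mB mC).
have mE A : measurable A -> (m1 \x m2)%E A = m A.
  by move=> mA; exact: (@product_measure_unique _ _ _ _ _ m1 m2 m rect).
have mul_meas : measurable_fun setT (fun z : R * R => (z.1 * z.2)%:E).
  apply/measurable_EFinP.
  by apply: measurable_funM; [exact: measurable_fst|exact: measurable_snd].
suff h : (\int[P]_t (f t * g t)%:E = 0)%E by rewrite /Rintegral h.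
have ifg := bounded_rv_integrable (bounded_rvM bf bg).
have im : m.-integrable setT (fun z : R * R => (z.1 * z.2)%:E).
  exact: (@integrable_pushforward _ _ _ _ _ _ mh P setT _ mul_meas ifg measurableT).
transitivity (\int[m]_z (z.1 * z.2)%:E)%E.
  have := (@integral_pushforward _ _ _ _ _ _ mh P setT _ mul_meas ifg measurableT).
  by rewrite preimage_setT => ->.
transitivity (\int[(m1 \x m2)%E]_z (z.1 * z.2)%:E)%E.
  apply: eq_measure_integral => A mA _. exact: (esym (mE A mA)).
have im' : ((m1 \x m2)%E).-integrable setT (fun z : R * R => (z.1 * z.2)%:E).
  case/integrableP : im => _ im; apply/integrableP; split => //.
  apply: le_lt_trans im; rewrite le_eqVlt; apply/orP; left; apply/eqP.
  apply: eq_measure_integral => A mA _; exact: (mE A mA).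
rewrite -(integral12_prod_meas1 im').
rewrite -[RHS](integral0 m1 setT); apply: eq_integral => x _.
rewrite /fubini_F /=.
have im2 : m2.-integrable setT (EFin : R -> \bar R).
  have me : measurable_fun setT (fun y : R => y%:E) by exact: EFin_measurable.
  exact: (@integrable_pushforward _ _ _ _ _ _ mg P setT _ me (bounded_rv_integrable bg) measurableT).
rewrite (eq_integral (fun y : R => (x%:E * y%:E)%E)) => [|y _]; last by rewrite EFinM.
rewrite integralZl//.
have me : measurable_fun setT (fun y : R => y%:E) by exact: EFin_measurable.
have -> : (\int[m2]_y y%:E = 0)%E.
  have := (@integral_pushforward _ _ _ _ _ _ mg P setT _ me (bounded_rv_integrable bg) measurableT).
  by rewrite preimage_setT => ->; rewrite -(EFin_Rexp bg) g0.
by rewrite mule0.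
Qed.

End bounded_rv_theory.

(** * Sigma-algebras generated by subfamilies *)

Section filtration.
Context (R : realType) (d : measure_display) (T : measurableType d)
  (P : probability T R) (I : finType) (Y : I -> T -> R).
Implicit Types D : {set I}.

(** The pi-system of events [Y i \in B i for every i in D]. *)
Definition rectangles D : set (set T) :=
  [set A | exists B : I -> set R, (forall i, measurable (B i)) /\
    A = \bigcap_(i in [set` D]) Y i @^-1` B i].

(** Bounded functions measurable for the sigma-algebra generated by the
    [Y i], [i] in [D]. They are the bounded variables on the space [T] endowed
    with that smaller sigma-algebra, hence inherit all closure properties of
    [bounded_rv]. *)
Definition adapted D (f : T -> R) :=
  @bounded_rv R _ (g_sigma_algebraType (rectangles D)) f.

Hypothesis bY : forall i, bounded_rv (Y i).

Lemma rectangles_setI D : setI_closed (rectangles D).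
Proof.
move=> _ _ [B [mB ->]] [C [mC ->]]; exists (fun i => B i `&` C i); split.
  by move=> i; exact: measurableI.
by rewrite -bigcapI.
Qed.

Lemma rectangles_measurable D : rectangles D `<=` measurable.
Proof.
move=> _ [B [mB ->]]; apply: fin_bigcap_measurable => // i _.
rewrite -[X in measurable X]setTI; exact: (bY i).1.
Qed.

Lemma sigma_rectangles_measurable D A :
  <<s rectangles D >> A -> measurable A.
Proof.
move: A; apply: smallest_sub; last exact: rectangles_measurable.
exact: sigma_algebra_measurable.
Qed.

Lemma adapted_bounded D f : adapted D f -> bounded_rv f.
Proof.
move=> [mf bf]; split => // _ A mA.
have := mf measurableT A mA; exact: sigma_rectangles_measurable.
Qed.

Lemma adapted_sub D D' f : D \subset D' -> adapted D f -> adapted D' f.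
Proof.
move=> sDD' [mf bf]; split => // _ A mA.
have := mf measurableT A mA; apply: sub_smallest2r.
  exact: smallest_sigma_algebra.
move=> _ [B [mB ->]].
exists (fun i => if i \in D then B i else setT); split.
  by move=> i; case: ifP.
apply/seteqP; split => t /= h i iD /=.
  by case: ifPn => // iD'; exact: h.
by have := h i; rewrite /= iD; apply; exact: (fintype.subsetP sDD').
Qed.

Lemma adapted_self D i : i \in D -> adapted D (Y i).
Proof.
move=> iD; split; last exact: (bY i).2.
move=> _ A mA; apply: sub_sigma_algebra; rewrite setTI.
exists (fun j => if j == i then A else setT); split.
  by move=> j; case: ifP.
apply/seteqP; split => t /= h.
  by move=> j _ /=; case: eqP => // ->.
by have := h i iD; rewrite /= eqxx.
Qed.

Hypothesis indY : forall (J : {set I}) (B : I -> set R),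
  (forall i, measurable (B i)) ->
  P (\bigcap_(i in [set` J]) (Y i @^-1` B i)) =
  (\prod_(i in J) P (Y i @^-1` B i))%E.

(** Independence passes from the pi-system of rectangles to the sigma-algebra
    it generates. *)
Lemma indep_sigma D k A B : k \notin D -> <<s rectangles D >> A ->
  measurable B -> P (A `&` Y k @^-1` B) = (P A * P (Y k @^-1` B))%E.
Proof.
move=> kD sA mB.
pose E := Y k @^-1` B.
have mE : measurable E by rewrite -[X in measurable X]setTI; exact: (bY k).1.
have PE0 : (0 <= fine (P E))%R by rewrite fine_ge0.
pose m1 := mrestr P mE.
pose m2 := mscale (NngNum PE0) P.
have m1E F : m1 F = P (F `&` E) by [].
have m2E F : m2 F = (P E * P F)%E.
  by transitivity ((fine (P E))%:E * P F)%E => //; rewrite fineK ?fin_num_measure.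
suff : m1 A = m2 A by rewrite m1E m2E muleC.
apply: (@g_sigma_algebra_measure_unique _ _ _ (rectangles D) _ (fun=> setT)) => //.
- exact: rectangles_measurable.
- move=> _; exists (fun=> setT); split => //.
  by apply/seteqP; split.
- by apply/seteqP; split => // t _; exists 0%N.
- exact: rectangles_setI.
- move=> _ [C [mC ->]].
  apply: etrans (m1E _) (etrans _ (esym (m2E _))).
  pose C' i := if i == k then B else C i.
  have mC' i : measurable (C' i) by rewrite /C'; case: ifP.
  have := indY (k |: D)%SET mC'; rewrite big_setU1//=.
  have -> : C' k = B by rewrite /C' eqxx.
  rewrite (eq_bigr (fun i => P (Y i @^-1` C i))); last first.
    by move=> i iD; rewrite /C'; case: eqP => // ik; rewrite -ik iD in kD.
  rewrite -(indY D mC) => <-; congr (P _); apply/seteqP; split => t /=.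
    move=> [h Et] i /=; rewrite !inE /C' => /orP[/eqP ->|iD].
      by rewrite eqxx.
    by case: eqP => [->//|_]; exact: h.
  move=> h; split.
    move=> i iD; have := h i; rewrite /= !inE iD orbT => /(_ isT).
    by rewrite /C'; case: eqP => // ik; rewrite -ik iD in kD.
  by have := h k; rewrite /= !inE eqxx => /(_ isT); rewrite /C' eqxx.
- by move=> _; apply: (@le_lt_trans _ _ (P (setT `&` E))) => //; rewrite setTI -ge0_fin_numE//; apply: fin_num_measure.
Qed.

(** The martingale difference property. *)
Lemma adapted_mul0 D k f : k \notin D -> adapted D f -> \int[P]_t Y k t = 0 ->
  \int[P]_t (f t * Y k t) = 0.
Proof.
move=> kD af Y0; apply: indep_Rexp_mul0 => //; first exact: adapted_bounded af.
move=> A B mA mB; apply: (indep_sigma kD) => //.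
by rewrite -[X in <<s _ >> X]setTI; apply: af.1.
Qed.

End filtration.

(** * Exponential moments and maximal inequalities for partial sums *)

Section elementary.
Context (R : realType).
Implicit Types x y : R.

(** For a centred variable [h] this replaces Hoeffding's lemma: the linear
    term integrates to zero. *)
Lemma expR_le_linear_sq x : expR x <= x + expR (2 * x ^+ 2).
Proof.
have e1 y : 1 + y <= expR y by exact: expR_ge1Dx.
have [x12|x12] := leP (1 / 2) x.
  have : expR x <= expR (2 * x ^+ 2) by rewrite ler_expR; nra.
  nra.
have [xm|xm] := leP x (- (1 / 2)).
  have := e1 (2 * x ^+ 2).
  have : expR x <= 1 by rewrite -expR0 ler_expR; lra.
  nra.
have := e1 (2 * x ^+ 2); have := e1 (- x).
rewrite expRN; have := expR_gt0 x; set E := expR x; set F := expR _.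
move=> E0 h1 h2.
have : E * (1 - x) <= 1 by rewrite -ler_pdivlMl ?mulr1.
nra.
Qed.

(** Used with a maximum of many [x] and [l] the logarithm of their number, the
    factor [expR (- l)] compensates the sum of the exponentials. *)
Lemma le_shift_expR (l x : R) : x <= l + expR (- l) * expR x.
Proof. by rewrite -expRD; have := @expR_ge1Dx R (- l + x); lra. Qed.

Lemma dyadic_scale (tau W : R) K : tau / 2 ^+ K / 2 <= W -> W <= tau ->
  exists2 k, (k <= K)%N & tau / 2 ^+ k / 2 <= W <= tau / 2 ^+ k.
Proof.
elim: K => [|K IH] h1 h2; first by exists 0%N => //; rewrite h1 expr0 divr1.
have [h|h] := leP W (tau / 2 ^+ K.+1); first by exists K.+1; rewrite // h1 h.
have [] := IH _ h2; last by move=> k kK hk; exists k => //; exact: leq_trans kK _.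
by rewrite -mulrA -invfM -exprSr ltW.
Qed.

End elementary.

Section maximal.
Context (R : realType) (d : measure_display) (T : measurableType d)
  (P : probability T R) (I : finType) (Y : I -> T -> R) (C : R) (a : I -> R).
Hypothesis bY : forall i, bounded_rv (Y i).
Hypothesis YC : forall i t, `|Y i t| <= C.
Hypothesis Y0 : forall i, \int[P]_t Y i t = 0.
Hypothesis indY : forall (J : {set I}) (B : I -> set R),
  (forall i, measurable (B i)) ->
  P (\bigcap_(i in [set` J]) (Y i @^-1` B i)) =
  (\prod_(i in J) P (Y i @^-1` B i))%E.

(** The weighted sum of the variables listed in [s]. A list, rather than a set,
    of indices records the order in which the partial sums are formed. *)
Definition psum (s : seq I) (t : T) : R := \sum_(j <- s) a j * Y j t.

(** An upper bound for the variance of [psum s], obtained from [`|Y i| <= C]. *)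
Definition qvar (s : seq I) : R := C ^+ 2 * \sum_(j <- s) a j ^+ 2.

(** The index set of the sigma-algebra generated by the variables in [s]. *)
Definition natfilt (s : seq I) : {set I} := [set j in s]%SET.

Lemma psum_adapted s : adapted Y (natfilt s) (psum s).
Proof.
suff h s' : {subset s' <= s} -> adapted Y (natfilt s) (psum s') by exact: h.
elim: s' => [|j s' IH] ss'; rewrite /psum.
  by under eq_fun do rewrite big_nil; exact: bounded_rv_cst.
under eq_fun do rewrite big_cons.
apply: bounded_rvD; last by apply: IH => x xs; apply: ss'; rewrite inE xs orbT.
apply: bounded_rvZ; apply: adapted_self => //.
by rewrite inE; apply: ss'; rewrite inE eqxx.
Qed.

Lemma psum_rcons s j t : psum (rcons s j) t = psum s t + a j * Y j t.
Proof. by rewrite /psum -cats1 big_cat big_seq1. Qed.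

Lemma qvar_rcons s j : qvar (rcons s j) = qvar s + C ^+ 2 * a j ^+ 2.
Proof. by rewrite /qvar -cats1 big_cat big_seq1 mulrDr. Qed.

Lemma qvar_ge0 s : 0 <= qvar s.
Proof. by apply: mulr_ge0; [exact: sqr_ge0|apply: sumr_ge0 => j _; exact: sqr_ge0]. Qed.

Lemma notin_natfilt s j : uniq (rcons s j) -> j \notin natfilt s.
Proof. by rewrite rcons_uniq inE => /andP[]. Qed.

Lemma expR_psum_adapted s (c : R) :
  adapted Y (natfilt s) (fun t => expR (c * psum s t ^+ 2)).
Proof. exact/bounded_rv_expR/bounded_rvZ/bounded_rvX/psum_adapted. Qed.

Lemma adapted_mul_increment s j f : uniq (rcons s j) ->
  adapted Y (natfilt s) f -> \int[P]_t (f t * (a j * Y j t)) = 0.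
Proof.
move=> us af.
under eq_Rintegral do rewrite mulrA (mulrC (f _)).
apply: (adapted_mul0 bY indY (notin_natfilt us)) => //.
exact: bounded_rvZ.
Qed.

(** By induction on the number of terms: conditioning on all terms but the last
    one, of square at most [b2], replaces the parameter [c] by
    [c * (1 + 8 * c * b2)] at the cost of a factor [expR (c * b2)]. *)
Lemma psum_sq_exp_moment s (c : R) : uniq s -> 0 <= c -> 16 * c * qvar s <= 1 ->
  \int[P]_t expR (c * psum s t ^+ 2) <= expR (2 * c * qvar s).
Proof.
elim/last_ind: s c => [|s j IH] c us c0 hc.
  under eq_Rintegral do rewrite /psum big_nil expr0n mulr0 expR0.
  by rewrite Rexp_cst /qvar big_nil !mulr0 expR0.
have us' : uniq s by move: us; rewrite rcons_uniq => /andP[].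
rewrite qvar_rcons in hc *.
set b2 := C ^+ 2 * a j ^+ 2 in hc *.
have b20 : 0 <= b2 by rewrite mulr_ge0 ?sqr_ge0.
have V0 := qvar_ge0 s.
have cbV : c * b2 * (16 * c * qvar s) <= c * b2 * 1.
  apply: ler_wpM2l; first exact: mulr_ge0.
  by have := mulr_ge0 c0 b20; lra.
pose c' := c * (1 + 8 * c * b2).
have c'0 : 0 <= c' by rewrite /c'; apply: mulr_ge0 => //; nra.
have hh t : (a j * Y j t) ^+ 2 <= b2.
  rewrite exprMn mulrC ler_wpM2r ?sqr_ge0// -real_normK ?num_real//.
  by rewrite lerXn2r ?nnegrE ?normr_ge0// (le_trans _ (YC j t)).
have bps := adapted_bounded bY (psum_adapted s).
have bpr := adapted_bounded bY (psum_adapted (rcons s j)).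
have bh : bounded_rv (fun t => a j * Y j t) by exact: bounded_rvZ.
have step t : expR (c * psum (rcons s j) t ^+ 2) <=
    expR (c * b2) * (2 * c * (psum s t * expR (c * psum s t ^+ 2) * (a j * Y j t))
                     + expR (c' * psum s t ^+ 2)).
  rewrite psum_rcons; set S := psum s t; set h := a j * Y j t.
  have hb : h ^+ 2 <= b2 := hh t.
  have -> : c * (S + h) ^+ 2 = c * h ^+ 2 + (c * S ^+ 2 + 2 * c * S * h) by ring.
  rewrite expRD; apply: ler_pM; rewrite ?expR_ge0//.
    by rewrite ler_expR ler_wpM2l.
  rewrite expRD.
  apply: (@le_trans _ _ (expR (c * S ^+ 2) * (2 * c * S * h + expR (8 * c ^+ 2 * b2 * S ^+ 2)))).
    rewrite ler_wpM2l ?expR_ge0//; apply: le_trans (expR_le_linear_sq _) _.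
    rewrite lerD2l ler_expR.
    have : 0 <= c ^+ 2 * S ^+ 2 by rewrite mulr_ge0 ?sqr_ge0.
    nra.
  rewrite mulrDr -expRD le_eqVlt; apply/orP; left; apply/eqP; congr (_ + _).
    by ring.
  by congr expR; rewrite /c'; ring.
apply: (@le_trans _ _ (expR (c * b2) * expR (2 * c' * qvar s))); last first.
  rewrite -expRD ler_expR /c'.
  lra.
have bE1 : bounded_rv (fun t => psum s t * expR (c * psum s t ^+ 2) * (a j * Y j t)).
  apply: bounded_rvM => //; apply: bounded_rvM => //.
  exact/bounded_rv_expR/bounded_rvZ/bounded_rvX.
have bE2 : bounded_rv (fun t => expR (c' * psum s t ^+ 2)).
  exact/bounded_rv_expR/bounded_rvZ/bounded_rvX.
apply: le_trans.
  apply: Rexp_le step.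
- exact/bounded_rv_expR/bounded_rvZ/bounded_rvX.
- by apply/bounded_rvZ/bounded_rvD => //; exact: bounded_rvZ.
rewrite RexpZ; last by apply/bounded_rvD => //; exact: bounded_rvZ.
rewrite RexpD//; last exact: bounded_rvZ.
rewrite RexpZ// (adapted_mul_increment us)//; last first.
  apply: bounded_rvM; [exact: psum_adapted|exact: expR_psum_adapted].
rewrite mulr0 add0r ler_wpM2l ?expR_ge0//.
apply: IH => //.
have : 0 <= c * b2 by exact: mulr_ge0.
rewrite /c'; lra.
Qed.

(** The maximum of [expR (c * psum (take q s) t ^ 2)] over all prefixes of [s],
    indexed from the longest to the shortest so that the last prefix is split
    off first; the default value 0 is harmless as all terms are positive. *)
Definition runmax (c : R) (s : seq I) (t : T) : R :=
  \big[Num.max/0]_(q < (size s).+1) expR (c * psum (take (size s - q) s) t ^+ 2).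

Lemma runmax_ge0 c s t : 0 <= runmax c s t.
Proof. by rewrite /runmax; apply: bigmax_ge_id. Qed.

Lemma runmax_ge c s t q : expR (c * psum (take q s) t ^+ 2) <= runmax c s t.
Proof.
have h q' : (q' <= size s)%N -> expR (c * psum (take q' s) t ^+ 2) <= runmax c s t.
  move=> q's; rewrite -(subKn q's).
  have k : (size s - q' < (size s).+1)%N by rewrite ltnS leq_subr.
  exact: (le_bigmax _ (fun q : 'I_(size s).+1 =>
    expR (c * psum (take (size s - q) s) t ^+ 2)) (Ordinal k)).
have [/h//|sq] := leqP q (size s).
by have := h _ (leqnn _); rewrite take_size take_oversize// ltnW.
Qed.

Lemma runmax_rcons c s j t : runmax c (rcons s j) t =
  Num.max (expR (c * psum (rcons s j) t ^+ 2)) (runmax c s t).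
Proof.
rewrite /runmax size_rcons big_ord_recl subn0 take_oversize ?size_rcons//.
congr (Num.max _ _); apply: eq_bigr => q _; rewrite -cats1 takel_cat//.
by rewrite /= /bump /= add1n subSS leq_subr.
Qed.

Lemma runmax_nil c t : runmax c [::] t = 1.
Proof.
rewrite /runmax big_ord_recl big_ord0 /= /psum big_nil expr0n mulr0 expR0.
by rewrite max_l.
Qed.

Lemma runmax_adapted c s : adapted Y (natfilt s) (runmax c s).
Proof.
elim/last_ind: s => [|s j IH].
  have -> : runmax c [::] = fun=> 1 by apply/funext => t; rewrite runmax_nil.
  exact: bounded_rv_cst.
have -> : runmax c (rcons s j) = fun t => Num.max
    (expR (c * psum (rcons s j) t ^+ 2)) (runmax c s t).
  by apply/funext => t; rewrite runmax_rcons.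
apply: bounded_rv_max; first exact: expR_psum_adapted.
apply: adapted_sub IH; apply/fintype.subsetP => i; rewrite !inE mem_rcons inE => ->.
by rewrite orbT.
Qed.

(** The expectation form of a pathwise inequality behind Doob's L^2 maximal
    inequality. With [M] the running maximum of [F], the quantity
    [2 * M * F - M ^ 2] grows at each step by at least [2 * M] times the
    increment of [F], and this has nonnegative expectation because [F] is a
    convex function of the martingale [psum]. *)
Lemma doob_step s (c : R) : uniq s -> 0 <= c ->
  0 <= \int[P]_t (2 * (runmax c s t * expR (c * psum s t ^+ 2)) - runmax c s t ^+ 2).
Proof.
move=> + c0; elim/last_ind: s => [_|s j IH us].
  under eq_Rintegral do rewrite runmax_nil /psum big_nil expr0n mulr0 expR0.
  rewrite Rexp_cst; lra.
have us' : uniq s by move: us; rewrite rcons_uniq => /andP[].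
have bM s' := adapted_bounded bY (runmax_adapted c s').
have bE s' := adapted_bounded bY (expR_psum_adapted s' c).
have bps s' := adapted_bounded bY (psum_adapted s').
have bh : bounded_rv (fun t => a j * Y j t) by exact: bounded_rvZ.
have bF s' : bounded_rv (fun t => 2 * (runmax c s' t * expR (c * psum s' t ^+ 2)) - runmax c s' t ^+ 2).
  by apply: bounded_rvB; [exact/bounded_rvZ/bounded_rvM|exact: bounded_rvX].
have bG : bounded_rv (fun t => 4 * c * (runmax c s t * expR (c * psum s t ^+ 2) * psum s t * (a j * Y j t))).
  by apply: bounded_rvZ; apply: bounded_rvM => //; apply: bounded_rvM => //; apply: bounded_rvM.
apply: le_trans (IH us') _.
rewrite -[leLHS]addr0.
have {1}-> : 0 = \int[P]_t (4 * c * (runmax c s t * expR (c * psum s t ^+ 2) * psum s t * (a j * Y j t))).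
  rewrite RexpZ; last first.
    by apply: bounded_rvM => //; apply: bounded_rvM => //; apply: bounded_rvM.
  rewrite (adapted_mul_increment us) ?mulr0//.
  apply: bounded_rvM; last exact: psum_adapted.
  by apply: bounded_rvM; [exact: runmax_adapted|exact: expR_psum_adapted].
rewrite -RexpD//; apply: Rexp_le => //; first exact: bounded_rvD.
move=> t.
rewrite runmax_rcons psum_rcons.
have M0 := runmax_ge0 c s t.
set M := runmax c s t in M0 *; set S := psum s t; set h := a j * Y j t.
set F := expR (c * S ^+ 2); set F' := expR (c * (S + h) ^+ 2).
have F0 : 0 <= F by exact: expR_ge0.
have FF' : F + 2 * c * F * S * h <= F'.
  rewrite /F'.
  have -> : c * (S + h) ^+ 2 = c * S ^+ 2 + (2 * c * S * h + c * h ^+ 2) by ring.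
  rewrite expRD -/F.
  apply: (@le_trans _ _ (F * (1 + (2 * c * S * h + c * h ^+ 2)))).
    have : 0 <= F * (c * h ^+ 2) by rewrite mulr_ge0// mulr_ge0// sqr_ge0.
    nra.
  by rewrite ler_wpM2l// expR_ge1Dx.
apply: (@le_trans _ _ (2 * M * F' - M ^+ 2)).
  have : M * (F + 2 * c * F * S * h) <= M * F' by rewrite ler_wpM2l.
  nra.
rewrite /Num.max; case: ifPn => _; first lra.
have := sqr_ge0 (F' - M); rewrite sqrrB; lra.
Qed.

(** Doob's L^2 maximal inequality for [expR (c * psum s t ^ 2)], combined with
    the exponential moment of the full sum. *)
Lemma doob_exp_sq s (c : R) : uniq s -> 0 <= c -> 16 * (2 * c) * qvar s <= 1 ->
  \int[P]_t (runmax c s t ^+ 2) <= 8.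
Proof.
move=> us c0 hc.
have bM s' := adapted_bounded bY (runmax_adapted c s').
have bps s' := adapted_bounded bY (psum_adapted s').
have bE : bounded_rv (fun t => expR (2 * c * psum s t ^+ 2)).
  exact/bounded_rv_expR/bounded_rvZ/bounded_rvX.
have h : \int[P]_t (2 * (runmax c s t * expR (c * psum s t ^+ 2)) - runmax c s t ^+ 2) <=
  \int[P]_t (2 * expR (2 * c * psum s t ^+ 2) - 2^-1 * runmax c s t ^+ 2).
  apply: Rexp_le.
  - apply: bounded_rvB; [apply/bounded_rvZ/bounded_rvM => //|exact: bounded_rvX].
    exact/bounded_rv_expR/bounded_rvZ/bounded_rvX.
  - by apply: bounded_rvB; [exact: bounded_rvZ|exact/bounded_rvZ/bounded_rvX].
  move=> t; set M := runmax c s t.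
  have -> : 2 * c * psum s t ^+ 2 = c * psum s t ^+ 2 + c * psum s t ^+ 2 by ring.
  rewrite expRD; set F := expR _.
  have := sqr_ge0 (M - 2 * F); rewrite -(@ler_pM2l _ 2^-1) ?invr_gt0//.
  lra.
have := le_trans (doob_step us c0) h.
rewrite RexpB; [|exact: bounded_rvZ|exact/bounded_rvZ/bounded_rvX].
rewrite !RexpZ//; last exact: bounded_rvX.
have := psum_sq_exp_moment us (mulr_ge0 (ler0n R 2) c0) hc.
set E := \int[P]_t _; set F := \int[P]_t _.
have : expR (2 * (2 * c) * qvar s) <= 2.
  apply: (@le_trans _ _ (expR (1 / 2))); first by rewrite ler_expR; lra.
  have := @expR_ge1Dx R (- (1 / 2)); rewrite expRN.
  have := expR_gt0 (1 / 2 : R); set G := expR _ => G0 h1.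
  have : G * (1 / 2) <= 1 by rewrite -ler_pdivlMl ?mulr1//; lra.
  lra.
lra.
Qed.

End maximal.

(** * One-sided maximal functions *)

(** A longest prefix of weight at most [v]. *)
Lemma maximal_prefix (R : realType) (I : Type) (s : seq I) (w : I -> R) (v : R) :
  0 <= v -> exists n, \sum_(j <- take n s) w j <= v /\
    forall q, (q <= size s)%N -> \sum_(j <- take q s) w j <= v -> (q <= n)%N.
Proof.
move=> v0; pose A := [pred q : 'I_(size s).+1 | \sum_(j <- take q s) w j <= v].
have [|q Aq qE] := @eq_bigmax_cond _ A (fun q => nat_of_ord q).
  by apply/card_gt0P; exists ord0; rewrite inE /= take0 big_nil.
exists q; split => // p ps hp; rewrite -qE.
have Ap : A (inord p) by rewrite /= inordK.
have := @leq_bigmax_cond _ A (fun q => nat_of_ord q) _ Ap.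
by rewrite inordK.
Qed.

Section domination.
Context (R : realType) (d : measure_display) (T : measurableType d)
  (P : probability T R) (I : finType) (Y : I -> T -> R) (C : R) (a : I -> R).
Hypothesis bY : forall i, bounded_rv (Y i).
Hypothesis C0 : 0 < C.
Hypothesis YC : forall i t, `|Y i t| <= C.
Hypothesis Y0 : forall i, \int[P]_t Y i t = 0.
Hypothesis indY : forall (J : {set I}) (B : I -> set R),
  (forall i, measurable (B i)) ->
  P (\bigcap_(i in [set` J]) (Y i @^-1` B i)) =
  (\prod_(i in J) P (Y i @^-1` B i))%E.

(** A law of the iterated logarithm in expectation: [D] dominates the squares of
    the partial sums relative to their weights, and its mean only grows with
    the logarithm of the number [K + 1] of dyadic scales of the weights. *)
Lemma prefix_domination (w : I -> R) (tau : R) (K : nat) (s : seq I) :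
  0 < tau -> uniq s -> (forall j, a j ^+ 2 <= w j) ->
  (forall j, tau / 2 ^+ K / 2 <= w j) -> \sum_(j <- s) w j <= tau ->
  exists D : T -> R, [/\ bounded_rv D, forall t, 0 <= D t,
    \int[P]_t D t <= 32 * C ^+ 2 * (ln K.+1%:R + 8) &
    forall q t, psum Y a (take q s) t ^+ 2 <= (\sum_(j <- take q s) w j) * D t].
Proof.
move=> tau0 us aw wK wtau.
pose v k := tau / 2 ^+ k : R.
have v0 k : 0 < v k by rewrite divr_gt0 ?exprn_gt0.
have w0 j : 0 <= w j by apply: le_trans (aw j); exact: sqr_ge0.
have C2 : 0 <= 32 * C ^+ 2 by apply: mulr_ge0; [|exact: sqr_ge0].
have [n nP] := choice (fun k => maximal_prefix s w (ltW (v0 k))).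
(* The largest parameter for which [doob_exp_sq] applies at scale [v k]. *)
pose c k := (32 * C ^+ 2 * v k)^-1.
have c0 k : 0 < c k by rewrite invr_gt0 !mulr_gt0// exprn_gt0.
pose M k := runmax Y a (c k) (take (n k) s).
have bM k : bounded_rv (M k) := adapted_bounded bY (runmax_adapted a bY (c k) (take (n k) s)).
have EM k : \int[P]_t (M k t ^+ 2) <= 8.
  apply: (doob_exp_sq bY YC Y0 indY) => //; [exact: take_uniq|exact: ltW|].
  have h : \sum_(j <- take (n k) s) a j ^+ 2 <= v k.
    by apply: le_trans (nP k).1; apply: ler_sum.
  rewrite /qvar /c invfM mulrA.
  have -> : 16 * (2 * ((32 * C ^+ 2)^-1 / v k)) * C ^+ 2 = (v k)^-1.
    by field; rewrite !gt_eqF.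
  by rewrite mulrC ler_pdivrMr// mul1r.
pose l : R := ln K.+1%:R.
have l0 : 0 <= l by apply: ln_ge0; rewrite ler1n.
have el : expR (- l) = K.+1%:R^-1 by rewrite expRN lnK// posrE ltr0n.
pose D t := 32 * C ^+ 2 * (l + K.+1%:R^-1 * \sum_(k < K.+1) M k t ^+ 2).
have bS : bounded_rv (fun t => \sum_(k < K.+1) M k t ^+ 2).
  by apply: bounded_rv_sum => k; exact: bounded_rvX.
have M0 t : 0 <= \sum_(k < K.+1) M k t ^+ 2.
  by apply: sumr_ge0 => k _; exact: sqr_ge0.
have D0 t : 0 <= D t.
  rewrite /D; apply: mulr_ge0; first exact: C2.
  by apply: addr_ge0 => //; apply: mulr_ge0; rewrite ?invr_ge0.
exists D; split => //.
- apply: bounded_rvZ; apply: bounded_rvD; [exact: bounded_rv_cst|exact: bounded_rvZ].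
- rewrite RexpZ; last by apply: bounded_rvD; [exact: bounded_rv_cst|exact: bounded_rvZ].
  rewrite ler_wpM2l//.
  rewrite RexpD; [|exact: bounded_rv_cst|exact: bounded_rvZ].
  rewrite Rexp_cst lerD2l RexpZ// ler_pdivrMl ?ltr0n//.
  rewrite Rexp_sum; last by move=> k; exact: bounded_rvX.
  apply: (@le_trans _ _ (\sum_(k < K.+1) 8)); first by apply: ler_sum => k _; exact: EM.
  by rewrite sumr_const card_ord mulr_natl.
move=> q t.
wlog qs : q / (q <= size s)%N.
  move=> H; have [/H//|sq] := leqP q (size s).
  by have := H _ (leqnn (size s)); rewrite take_size take_oversize// ltnW.
case: q qs => [|q] qs; first by rewrite take0 /psum !big_nil expr0n mul0r.
set W := \sum_(j <- _) _.
have WK : tau / 2 ^+ K / 2 <= W.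
  have : take q.+1 s <> [::] by case: (s) qs.
  rewrite /W; case: (take q.+1 s) => // j s' _.
  by rewrite big_cons (le_trans (wK j))// lerDl sumr_ge0.
have Wtau : W <= tau.
  apply: le_trans wtau; rewrite -[in leRHS](cat_take_drop q.+1 s) big_cat lerDl.
  exact: sumr_ge0.
have [k kK /andP[Wk1 Wk2]] := dyadic_scale WK Wtau.
have qn : (q.+1 <= n k)%N by apply: (nP k).2.
have hM : expR (2 * c k * psum Y a (take q.+1 s) t ^+ 2) <= M k t ^+ 2.
  have -> : 2 * c k * psum Y a (take q.+1 s) t ^+ 2 =
     c k * psum Y a (take q.+1 s) t ^+ 2 + c k * psum Y a (take q.+1 s) t ^+ 2 by ring.
  rewrite expRD -expr2 lerXn2r ?nnegrE ?expR_ge0 ?runmax_ge0//.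
  have := runmax_ge Y a (c k) (take (n k) s) t q.+1.
  by rewrite take_takel.
have hS : M k t ^+ 2 <= \sum_(k < K.+1) M k t ^+ 2.
  have kK' : (k < K.+1)%N by [].
  rewrite (bigD1 (Ordinal kK'))//= lerDl.
  by apply: sumr_ge0 => i _; exact: sqr_ge0.
have h1 := le_shift_expR l (2 * c k * psum Y a (take q.+1 s) t ^+ 2).
rewrite el in h1.
have h2 : 2 * c k * psum Y a (take q.+1 s) t ^+ 2 <=
    l + K.+1%:R^-1 * \sum_(k < K.+1) M k t ^+ 2.
  apply: le_trans h1 _; rewrite lerD2l ler_wpM2l ?invr_ge0//.
  exact: le_trans hM hS.
set S2 := psum Y a _ t ^+ 2 in h2 *.
rewrite /D; set E := l + _ in h2 *.
have E0 : 0 <= E by apply: le_trans h2; rewrite mulr_ge0 ?sqr_ge0// mulr_ge0// ltW.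
have -> : S2 = 16 * C ^+ 2 * v k * (2 * c k * S2).
  by rewrite /c; field; rewrite !gt_eqF.
apply: (@le_trans _ _ (16 * C ^+ 2 * v k * E)).
  by rewrite ler_wpM2l// !mulr_ge0 ?sqr_ge0// ltW.
have h3 : v k <= 2 * W by move: Wk1; rewrite -/(v k); lra.
have : C ^+ 2 * E * v k <= C ^+ 2 * E * (2 * W).
  by rewrite ler_wpM2l// mulr_ge0// sqr_ge0.
lra.
Qed.

End domination.

(** * The V^2 norm as a finite maximum *)

Section V2norm_theory.
Context (R : realType) (N : nat).
Implicit Types (b : 'I_N -> R) (Q : {set {set 'I_N}}).

(** The sum of the squared block sums of [b] over the family [Q]. *)
Definition qsum b Q : R := \sum_(A in Q) (\sum_(n in A) b n) ^+ 2.

Lemma qsum_ge0 b Q : 0 <= qsum b Q.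
Proof. by apply: sumr_ge0 => A _; exact: sqr_ge0. Qed.

Lemma qsum_normE b Q : \sum_(A in Q) `|\sum_(n in A) b n| ^+ 2 = qsum b Q.
Proof. by apply: eq_bigr => A _; rewrite real_normK// num_real. Qed.

(** A monotone labelling of the indices cuts them into intervals; labels that
    are not attained contribute an empty sum. *)
Lemma label_partition (M : nat) (g : 'I_N -> 'I_M) :
  {homo g : i j / (i <= j)%N} ->
  exists2 Q, interval_partition Q &
    forall b, qsum b Q = \sum_(l < M) (\sum_(n | g n == l) b n) ^+ 2.
Proof.
move=> gmono; pose h (l : 'I_M) := [set y | g y == l]%SET.
exists (preim_partition g [set: 'I_N]%SET).
  rewrite /interval_partition preim_partitionP /=.
  apply/forallP => A; apply/implyP => /imsetP[x _ ->].
  have [i gi imin] := @arg_minnP _ x (fun y => g y == g x) (@nat_of_ord N) (eqxx _).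
  have [j gj jmax] := @arg_maxnP _ x (fun y => g y == g x) (@nat_of_ord N) (eqxx _).
  apply/existsP; exists i; apply/existsP; exists j; apply/eqP/setP => y.
  rewrite !inE /= eq_sym; apply/idP/idP => [gy|/andP[iy yj]].
    by rewrite imin//; exact: jmax.
  apply/eqP/val_inj/eqP; rewrite /= eqn_leq.
  have := gmono _ _ iy; have := gmono _ _ yj.
  by rewrite (eqP gi) (eqP gj) => -> ->.
move=> b.
have -> : preim_partition g [set: 'I_N]%SET = [set h l | l in [set g x | x in [set: 'I_N]%SET]%SET]%SET.
  rewrite -imset_comp; apply: eq_imset => x; apply/setP => y.
  by rewrite !inE /= eq_sym.
rewrite /qsum big_imset /=; last first.
  move=> l l' /imsetP[x _ ->] _ /setP /(_ x).
  by rewrite !inE eqxx => /esym/eqP.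
rewrite [RHS](bigID (mem [set g x | x in [set: 'I_N]%SET]%SET)) /=.
rewrite [X in _ = _ + X]big1 ?addr0.
  apply: eq_bigr => l _; congr (_ ^+ 2); apply: eq_bigl => n.
  by rewrite !inE.
move=> l /imsetP lg; rewrite big_pred0 ?expr0n// => n; apply/negbTE/eqP => gn.
by apply: lg; exists n; rewrite ?inE.
Qed.

Lemma exists_interval_partition : exists Q : {set {set 'I_N}}, interval_partition Q.
Proof.
have [Q iQ _] := @label_partition N id (fun i j h => h).
by exists Q.
Qed.

Lemma V2norm_sqE b :
  V2norm b ^+ 2 = \big[Num.max/0]_(Q : {set {set 'I_N}} | interval_partition Q) qsum b Q.
Proof.
set E := [set Num.sqrt (\sum_(A in Q) `|\sum_(n in A) b n| ^+ 2)
      | Q in [set Q : {set {set 'I_N}} | interval_partition Q]].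
have ubE : has_ubound E.
  exists (\sum_Q Num.sqrt (qsum b Q)) => _ [Q _ <-]; rewrite qsum_normE.
  rewrite (bigD1 Q)//= lerDl; apply: sumr_ge0 => ? _; exact: sqrtr_ge0.
have [Q0 iQ0] := exists_interval_partition.
have EV Q : interval_partition Q -> Num.sqrt (qsum b Q) <= V2norm b.
  by move=> iQ; apply: (ub_le_sup ubE); exists Q; rewrite // qsum_normE.
have V0 : 0 <= V2norm b by apply: le_trans (EV _ iQ0); exact: sqrtr_ge0.
apply/eqP; rewrite eq_le; apply/andP; split; last first.
  apply: bigmax_le => [|Q iQ]; first exact: sqr_ge0.
  rewrite -[leLHS]sqr_sqrtr ?qsum_ge0//.
  by rewrite lerXn2r ?nnegrE ?sqrtr_ge0// EV.
set B := \big[_/_]_(_ | _) _.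
have B0 : 0 <= B by exact: bigmax_ge_id.
rewrite -[leRHS]sqr_sqrtr// lerXn2r ?nnegrE ?sqrtr_ge0//.
apply: ge_sup; first by exists (Num.sqrt (qsum b Q0)); exists Q0; rewrite // qsum_normE.
move=> _ [Q iQ <-]; rewrite qsum_normE ler_wsqrtr//.
exact: (le_bigmax_cond _ (fun Q => qsum b Q)).
Qed.

Lemma V2norm_sq_ge b Q : interval_partition Q -> qsum b Q <= V2norm b ^+ 2.
Proof. by move=> iQ; rewrite V2norm_sqE; exact: (le_bigmax_cond _ (fun Q => qsum b Q)). Qed.

Lemma V2norm_sq_le b (B : R) : (forall Q, interval_partition Q -> qsum b Q <= B) ->
  V2norm b ^+ 2 <= B.
Proof.
move=> h; rewrite V2norm_sqE; apply: bigmax_le => //.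
by have [Q iQ] := exists_interval_partition; apply: le_trans (h _ iQ); exact: qsum_ge0.
Qed.

Lemma measurable_V2norm_sq (d : measure_display) (T : measurableType d)
    (b : 'I_N -> T -> R) : (forall i, measurable_fun setT (b i)) ->
  measurable_fun setT (fun t => V2norm (fun i => b i t) ^+ 2).
Proof.
move=> mb; under eq_fun do rewrite V2norm_sqE.
elim: (index_enum _) => [|Q s IH]; first by under eq_fun do rewrite big_nil; exact: measurable_cst.
under eq_fun do rewrite big_cons.
case: (interval_partition Q) => //; apply: measurable_maxr => //.
rewrite /qsum.
under eq_fun do rewrite big_mkcond /=.
apply: measurable_sum => A; case: (A \in Q); last exact: measurable_cst.
apply: measurable_funX.
under eq_fun do rewrite big_mkcond /=; apply: measurable_sum => i; case: (i \in A) => //.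
Qed.

(** The indices [i, i + 1, ...], starting at [i]. *)
Definition right_of (i : 'I_N) : seq 'I_N := drop i (enum 'I_N).
(** The indices [i - 1, i - 2, ...], in decreasing order and without [i]. *)
Definition left_of (i : 'I_N) : seq 'I_N := rev (take i (enum 'I_N)).

Lemma right_of_uniq i : uniq (right_of i).
Proof. exact/drop_uniq/enum_uniq. Qed.

Lemma left_of_uniq i : uniq (left_of i).
Proof. by rewrite rev_uniq; exact/take_uniq/enum_uniq. Qed.

Lemma mem_take_right_of q (i j : 'I_N) :
  (j \in take q (right_of i)) = (i <= j < i + q)%N.
Proof.
rewrite -(mem_map val_inj) map_take map_drop val_enum_ord drop_iota add0n take_iota mem_iota.
by have /= := ltn_ord j; rewrite /=; lia.
Qed.

Lemma mem_take_left_of q (i j : 'I_N) :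
  (j \in take q (left_of i)) = (i - q <= j < i)%N.
Proof.
rewrite take_rev mem_rev -(mem_map val_inj) map_drop map_take val_enum_ord.
rewrite size_takel; last by rewrite size_enum_ord ltnW.
rewrite take_iota drop_iota add0n mem_iota.
by have := ltn_ord j; have := ltn_ord i; rewrite /=; lia.
Qed.

(** Pointwise domination of the squared norm by the one-sided maximal
    functions. *)
Lemma V2norm_sq_le_maximal b (w Dr Dl : 'I_N -> R) : (forall i, 0 < w i) ->
  (forall i, 0 <= Dr i) -> (forall i, 0 <= Dl i) ->
  (forall i q, (\sum_(j <- take q (right_of i)) b j) ^+ 2
     <= (\sum_(j <- take q (right_of i)) w j) * Dr i) ->
  (forall i q, (\sum_(j <- take q (left_of i)) b j) ^+ 2
     <= (\sum_(j <- take q (left_of i)) w j) * Dl i) ->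
  V2norm b ^+ 2 <= \sum_i w i * (2 * (Dr i + Dl i)).
Proof.
move=> w0 Dr0 Dl0 hr hl; apply: V2norm_sq_le => Q /andP[pQ /forallP iQ].
rewrite /qsum [leRHS](_ : _ = \sum_(i in [set: 'I_N]%SET) w i * (2 * (Dr i + Dl i))); last first.
  by apply: eq_bigl => i; rewrite inE.
have /and3P[/eqP covQ tQ Q0] := pQ.
rewrite -covQ finset.big_trivIset//=; apply: ler_sum => A AQ.
have /existsP[p /existsP[r /eqP AE]] := implyP (iQ A) AQ.
have An0 : A != finset.set0 by apply: contraNneq Q0 => <-.
pose W := \sum_(j in A) w j.
have W0 : 0 < W.
  have /finset.set0Pn[x xA] := An0.
  rewrite /W (bigD1 x)//= ltr_pwDl//; apply: sumr_ge0 => j _; exact: ltW.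
(* Split the interval [A] at its point [i]. *)
have key i : i \in A -> (\sum_(n in A) b n) ^+ 2 <= W * (2 * (Dr i + Dl i)).
  move=> iA; have /andP[pi ir] : (p <= i <= r)%N by move: iA; rewrite AE inE.
  have split_sum (f : 'I_N -> R) : \sum_(n in A) f n =
      \sum_(j <- take (r.+1 - i) (right_of i)) f j + \sum_(j <- take (i - p) (left_of i)) f j.
    rewrite (bigID (fun n : 'I_N => (i <= n)%N)) /=.
    rewrite [in RHS]big_uniq ?take_uniq ?right_of_uniq//=.
    rewrite [X in _ = _ + X]big_uniq ?take_uniq ?left_of_uniq//=.
    congr (_ + _); apply: eq_bigl => n.
      by rewrite mem_take_right_of AE inE; lia.
    by rewrite mem_take_left_of AE inE; lia.
  rewrite /W !split_sum.
  have := hr i (r.+1 - i)%N; have := hl i (i - p)%N.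
  set x := \sum_(j <- take (r.+1 - i) _) b j; set y := \sum_(j <- take (i - p) _) b j.
  set u := \sum_(j <- take (r.+1 - i) _) w j; set v := \sum_(j <- take (i - p) _) w j.
  move=> hy hx.
  have u0 : 0 <= u by apply: sumr_ge0 => j _; exact: ltW.
  have v0 : 0 <= v by apply: sumr_ge0 => j _; exact: ltW.
  have := sqr_ge0 (x - y).
  have := mulr_ge0 u0 (Dl0 i); have := mulr_ge0 v0 (Dr0 i).
  lra.
rewrite -(ler_pM2l W0) {1}/W mulr_suml mulr_sumr; apply: ler_sum => i iA.
rewrite [leRHS]mulrCA.
apply: ler_wpM2l; [exact: ltW|exact: key].
Qed.

End V2norm_theory.

(** * Iterated logarithms *)

Section loglog.
Context (R : realType).

Lemma expR1_lt3 : expR 1 < 3 :> R.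
Proof.
(* The sixth power of [6 / 5] is still below 3. *)
have e6 : expR (6^-1 : R) <= 6 / 5.
  have := @expR_ge1Dx R (- 6^-1); rewrite expRN.
  have := expR_gt0 (6^-1 : R); set G := expR _ => G0 h1.
  have : G * (1 - 6^-1) <= 1 by rewrite -ler_pdivlMl ?mulr1//; lra.
  lra.
have -> : (1 : R) = 6%:R * 6^-1 by rewrite mulfV// pnatr_eq0.
rewrite expRM_natl; apply: (@le_lt_trans _ _ ((6 / 5) ^+ 6)).
  by rewrite lerXn2r ?nnegrE ?expR_ge0.
lra.
Qed.

Lemma ln_ge1 N : (3 <= N)%N -> 1 <= ln N%:R :> R.
Proof.
move=> N3; have N0 : 0 < N%:R :> R by rewrite ltr0n; lia.
rewrite -[leLHS]expRK ler_ln ?posrE ?expR_gt0//.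
by apply: le_trans (ltW expR1_lt3) _; rewrite ler_nat.
Qed.

Lemma lnln3_gt0 : 0 < ln (ln 3%:R) :> R.
Proof.
by apply: ln_gt0; rewrite -[ltLHS]expRK ltr_ln ?posrE ?expR_gt0 ?expR1_lt3.
Qed.

Lemma lnln_ge3 N : (3 <= N)%N -> ln (ln 3%:R) <= ln (ln N%:R) :> R.
Proof.
move=> N3.
have h n : (3 <= n)%N -> 0 < ln n%:R :> R by move=> n3; apply: lt_le_trans (ln_ge1 n3).
by rewrite ler_ln ?posrE ?h// ler_ln ?posrE ?ltr0n ?ler_nat//; lia.
Qed.

(** [up_log 2 N + 1] is the number of dyadic scales between 1 and 1 / N. *)
Lemma ln_up_log_le : exists2 B : R, 0 < B & forall N, (3 <= N)%N ->
  ln (up_log 2 N).+1%:R + 8 <= B * ln (ln N%:R).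
Proof.
have ln2 : 0 < ln 2 :> R by apply: ln_gt0; rewrite ltr1n.
pose A0 : R := (ln 2)^-1 + 2.
have A01 : 1 <= A0 by have := ln2; rewrite -invr_gt0 /A0; lra.
pose A : R := ln A0 + 8.
have A_ge0 : 0 <= A by have := ln_ge0 A01; rewrite /A; lra.
have l3 := lnln3_gt0.
exists (1 + A / ln (ln 3%:R)); first by rewrite ltr_pwDl// divr_ge0// ltW.
move=> N N3; have lN := ln_ge1 N3.
have lnN0 : 0 < ln N%:R :> R by apply: lt_le_trans lN.
have KN : (up_log 2 N).+1%:R <= A0 * ln N%:R.
  have h : ((up_log 2 N).-1)%:R * ln 2 <= ln N%:R :> R.
    rewrite mulr_natl -lnXn// ler_ln ?posrE ?exprn_gt0 ?ltr0n//; last lia.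
    by rewrite -natrX ler_nat ltnW// up_log_gtn//; lia.
  have h' : ((up_log 2 N).-1)%:R <= (ln 2)^-1 * ln N%:R :> R.
    by rewrite ler_pdivlMl// mulrC.
  have : (up_log 2 N).+1%:R <= ((up_log 2 N).-1)%:R + 2 :> R.
    by rewrite -natrD ler_nat; lia.
  rewrite /A0 mulrDl; lra.
have : ln (up_log 2 N).+1%:R <= ln A0 + ln (ln N%:R) :> R.
  rewrite -lnM ?posrE//; last by apply: lt_le_trans A01.
  by rewrite ler_ln ?posrE// mulr_gt0//; apply: lt_le_trans A01.
have : A <= A / ln (ln 3%:R) * ln (ln N%:R).
  by rewrite -mulrA ler_peMr// ler_pdivlMl// mulr1 lnln_ge3.
have AE : A = ln A0 + 8 by [].
lra.
Qed.

End loglog.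

(** * The upper bound *)

Section upper.
Context (R : realType) (N : nat) (d : measure_display) (T : measurableType d)
  (P : probability T R) (C : R) (a : 'I_N -> R).
Hypothesis N0 : (0 < N)%N.
Hypothesis C0 : 0 < C.

Lemma V2_upper_bounded (Y : 'I_N -> T -> R) :
  (forall i, bounded_rv (Y i)) -> (forall i t, `|Y i t| <= C) ->
  (forall i, \int[P]_t Y i t = 0) ->
  (forall (J : {set 'I_N}) (B : 'I_N -> set R), (forall i, measurable (B i)) ->
    P (\bigcap_(i in [set` J]) (Y i @^-1` B i)) =
    (\prod_(i in J) P (Y i @^-1` B i))%E) ->
  (\int[P]_t (V2norm (fun i => a i * Y i t) ^+ 2)%:E <=
   (256 * C ^+ 2 * (ln (up_log 2 N).+1%:R + 8) * \sum_i a i ^+ 2)%:E)%E.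
Proof.
move=> bY YC Y0 indY.
pose sg := \sum_i a i ^+ 2.
have mV : measurable_fun setT (fun t => (V2norm (fun i => a i * Y i t) ^+ 2)%:E).
  apply/measurable_EFinP/measurable_V2norm_sq => i.
  exact: (bounded_rvZ (a i) (bY i)).1.
have [sg0|sg0] := eqVneq sg 0.
  rewrite -/sg sg0 mulr0.
  have a0 i : a i = 0.
    apply/eqP; rewrite -sqrf_eq0; move/eqP: sg0.
    by rewrite psumr_eq0 => [/allP/(_ i)|j _]; [rewrite mem_index_enum; apply|exact: sqr_ge0].
  rewrite integral0_eq// => t _; congr EFin; apply/eqP; rewrite eq_le sqr_ge0 andbT.
  apply: V2norm_sq_le => Q _; rewrite /qsum big1// => A _.
  by rewrite big1 ?expr0n// => i _; rewrite a0 mul0r.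
have sgp : 0 < sg by rewrite lt_neqAle eq_sym sg0 sumr_ge0// => i _; exact: sqr_ge0.
pose w i := a i ^+ 2 + sg / N%:R.
have NR : 0 < N%:R :> R by rewrite ltr0n.
have sgN : 0 < sg / N%:R by rewrite divr_gt0.
have w0 i : 0 < w i by rewrite /w ltr_wpDl// sqr_ge0.
have wsum : \sum_i w i = 2 * sg.
  rewrite big_split/= sumr_const card_ord -[_ *+ N]mulr_natr divfK ?gt_eqF//.
  by rewrite -/sg; ring.
set L := ln _ + 8.
have ex (s : seq 'I_N) : uniq s -> exists D : T -> R, [/\ bounded_rv D, forall t, 0 <= D t,
    \int[P]_t D t <= 32 * C ^+ 2 * L &
    forall q t, psum Y a (take q s) t ^+ 2 <= (\sum_(j <- take q s) w j) * D t].
  move=> us; apply: (prefix_domination bY C0 YC Y0 indY (tau := 2 * sg)) => //.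
  - by rewrite mulr_gt0.
  - by move=> j; rewrite /w lerDl ltW.
  - move=> j; rewrite /w.
    have -> : 2 * sg / 2 ^+ up_log 2 N / 2 = sg / 2 ^+ up_log 2 N.
      by field; rewrite expf_neq0 ?pnatr_eq0.
    apply: (@le_trans _ _ (sg / N%:R)); last by rewrite lerDr sqr_ge0.
    rewrite ler_pM2l// lef_pV2 ?posrE ?exprn_gt0//.
    by rewrite -natrX ler_nat up_logP.
  - rewrite -wsum big_uniq//= [leRHS](bigID (mem s))/= lerDl.
    by apply: sumr_ge0 => i _; exact: ltW.
have [Dr DrP] := choice (fun i => ex _ (right_of_uniq i)).
have [Dl DlP] := choice (fun i => ex _ (left_of_uniq i)).
have bDr i : bounded_rv (Dr i) by have [] := DrP i.
have bDl i : bounded_rv (Dl i) by have [] := DlP i.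
have bD i : bounded_rv (fun t => w i * (2 * (Dr i t + Dl i t))).
  by apply/bounded_rvZ/bounded_rvZ/bounded_rvD.
have bS : bounded_rv (fun t => \sum_i w i * (2 * (Dr i t + Dl i t))).
  exact: bounded_rv_sum.
apply: (@le_trans _ _ (\int[P]_t (\sum_i w i * (2 * (Dr i t + Dl i t)))%:E)%E).
  apply: ge0_le_integral => //.
  - by move=> t _; rewrite lee_fin sqr_ge0.
  - by apply/measurable_EFinP; exact: bS.1.
  move=> t _; rewrite lee_fin; apply: V2norm_sq_le_maximal => //.
  - by move=> i; have [_ h1 _ _] := DrP i.
  - by move=> i; have [_ h1 _ _] := DlP i.
  - by move=> i q; have [_ _ _ h1] := DrP i; exact: h1.
  - by move=> i q; have [_ _ _ h1] := DlP i; exact: h1.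
rewrite -EFin_Rexp// lee_fin Rexp_sum//.
apply: (@le_trans _ _ (\sum_i w i * (128 * C ^+ 2 * L))).
  apply: ler_sum => i _; rewrite RexpZ; last by apply/bounded_rvZ/bounded_rvD.
  rewrite ler_pM2l// RexpZ ?RexpD//; last exact: bounded_rvD.
  have [_ _ h1 _] := DrP i; have [_ _ h2 _] := DlP i; lra.
by rewrite -mulr_suml wsum -/sg le_eqVlt; apply/orP; left; apply/eqP; ring.
Qed.

Lemma V2_upper (X : 'I_N -> {RV P >-> R}) :
  independent_RVs X -> (forall i, 'E_P[X i] = 0)%E ->
  (forall i, {ae P, forall t, `|X i t| <= C}) ->
  (\int[P]_t (V2norm (fun i => a i * X i t) ^+ 2)%:E <=
   (256 * C ^+ 2 * (ln (up_log 2 N).+1%:R + 8) * \sum_i a i ^+ 2)%:E)%E.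
Proof.
move=> indX X0 XC.
(* Truncation to [-C, C] changes the variables on a null set only. *)
pose clip (x : R) : R := Num.max (- C) (Num.min C x).
have mclip : measurable_fun setT clip.
  by apply: measurable_maxr => //; apply: measurable_minr.
have clipC x : `|clip x| <= C.
  rewrite /clip ler_norml le_max lexx/= ge_max ge_min lexx/= andbT.
  by rewrite (le_trans _ (ltW C0))// oppr_le0 ltW.
have clipE x : `|x| <= C -> clip x = x.
  by rewrite ler_norml /clip => /andP[h1 h2]; rewrite min_r// max_r.
pose Y i t := clip (X i t).
have mX i : measurable_fun setT (X i) by [].
have mY i : measurable_fun setT (Y i) by exact: measurableT_comp.
have bY i : bounded_rv (Y i) by split => //; exists C => t; exact: clipC.
have XY : {ae P, forall t i, X i t = Y i t}.
  apply: filter_forall => i; apply: filterS (XC i) => t h.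
  by rewrite /Y clipE.
have Y0 i : \int[P]_t Y i t = 0.
  suff : (\int[P]_t (Y i t)%:E = 0)%E by rewrite -EFin_Rexp// => -[].
  rewrite -(X0 i) unlock.
  apply: ae_eq_integral => //; [exact/measurable_EFinP|exact/measurable_EFinP|].
  by apply: filterS XY => t /(_ i) ->.
have indY (J : {set 'I_N}) (B : 'I_N -> set R) : (forall i, measurable (B i)) ->
    P (\bigcap_(i in [set` J]) (Y i @^-1` B i)) =
    (\prod_(i in J) P (Y i @^-1` B i))%E.
  move=> mB; apply: (indX J (fun i => clip @^-1` B i)) => i.
  by rewrite -[X in measurable X]setTI; exact: mclip.
have -> : (\int[P]_t (V2norm (fun i => a i * X i t) ^+ 2)%:E =
    \int[P]_t (V2norm (fun i => a i * Y i t) ^+ 2)%:E)%E.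
  apply: ae_eq_integral => //.
  - by apply/measurable_EFinP/measurable_V2norm_sq => i; exact: measurable_funM.
  - by apply/measurable_EFinP/measurable_V2norm_sq => i; exact: measurable_funM.
  apply: filterS XY => t XY _; congr ((V2norm _ ^+ 2)%:E).
  by apply/funext => i; rewrite XY.
exact: (V2_upper_bounded bY (fun i t => clipC (X i t)) Y0 indY).
Qed.

End upper.

Lemma V2_upper_constant (R : realType) (C : R) : 0 < C ->
  exists K : R, 0 < K /\
    forall (N : nat), (3 <= N)%N ->
    forall (d : measure_display) (T : measurableType d) (P : probability T R)
      (X : 'I_N -> {RV P >-> R}) (a : 'I_N -> R),
      independent_RVs X ->
      (forall i, 'E_P[X i] = 0)%E ->
      (forall i, {ae P, forall t, `|X i t| <= C}) ->
      (sqrte 'E_P[fun t => (V2norm (fun i => (a i * X i t)%R) ^+ 2)%R]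
       <= (K * Num.sqrt (ln (ln N%:R)) * Num.sqrt (\sum_(i < N) a i ^+ 2))%:E)%E.
Proof.
move=> C0; have [B B0 hB] := ln_up_log_le R.
have [k k0 hk] : exists2 k : R, 0 < k & forall (N : nat), (0 < N)%N ->
    forall (d : measure_display) (T : measurableType d) (P : probability T R)
      (X : 'I_N -> {RV P >-> R}) (a : 'I_N -> R),
      independent_RVs X ->
      (forall i, 'E_P[X i] = 0)%E ->
      (forall i, {ae P, forall t, `|X i t| <= C}) ->
      (\int[P]_t (V2norm (fun i => a i * X i t) ^+ 2)%:E <=
       (k * (ln (up_log 2 N).+1%:R + 8) * \sum_i a i ^+ 2)%:E)%E.
  exists (256 * C ^+ 2); first by apply: mulr_gt0; [lra|exact: exprn_gt0].
  by move=> N N0 d T P X a indX X0 XC; exact: V2_upper.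
have K0 : 0 < k * B by rewrite mulr_gt0.
exists (Num.sqrt (k * B)); split; first by rewrite sqrtr_gt0.
move=> N N3 d T P X a indX X0 XC.
have L0 : 0 <= ln (ln N%:R) :> R.
  by apply: ltW; apply: lt_le_trans (lnln3_gt0 R) (lnln_ge3 R N3).
have A0 : 0 <= \sum_(i < N) a i ^+ 2 by apply: sumr_ge0 => i _; exact: sqr_ge0.
rewrite -sqrtrM; last exact: ltW.
rewrite -sqrtrM; last by rewrite mulr_ge0// ltW.
apply: (@le_trans _ _ (sqrte (k * B * ln (ln N%:R) * \sum_(i < N) a i ^+ 2)%:E)) => //.
rewrite lee_sqrt; last by rewrite lee_fin !mulr_ge0// ?ltW.
rewrite unlock.
have N0 : (0 < N)%N by exact: leq_trans N3.
apply: le_trans (hk N N0 _ _ _ X a indX X0 XC) _.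
by rewrite lee_fin ler_wpM2r// -[leRHS]mulrA ler_wpM2l ?hB// ltW.
Qed.

(** * Averages over sign sequences *)

Section sign_average.
Context (R : realType).
Implicit Types (f g : seq R -> R) (s t : seq R).

(** The average of [f] over the [2 ^ m] sequences of signs of length [m], the
    first sign being averaged last. *)
Fixpoint signavg (m : nat) f : R :=
  if m is m'.+1 then
    (signavg m' (fun s => f (1 :: s)) + signavg m' (fun s => f (-1 :: s))) / 2
  else f [::].

(** The sequences over which [signavg m] averages. *)
Definition signseq (m : nat) s : bool :=
  (size s == m) && all (fun x => x ^+ 2 == 1) s.

Lemma signavg_le m f g : (forall s, signseq m s -> f s <= g s) ->
  signavg m f <= signavg m g.
Proof.
elim: m f g => [|m IH] f g fg /=; first exact: fg.
rewrite ler_pM2r ?invr_gt0//; apply: lerD; apply: IH => s /andP[sm sall];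
  by apply: fg; rewrite /signseq /= eqSS sm sall ?sqrrN expr1n eqxx.
Qed.

Lemma eq_signavg m f g : (forall s, signseq m s -> f s = g s) ->
  signavg m f = signavg m g.
Proof.
by move=> fg; apply/eqP; rewrite eq_le; apply/andP; split;
  apply: signavg_le => s hs; rewrite fg.
Qed.

Lemma signavg_cst m (c : R) : signavg m (fun=> c) = c.
Proof. by elim: m => //= m ->; field. Qed.

Lemma signavgD m f g : signavg m (fun s => f s + g s) = signavg m f + signavg m g.
Proof. by elim: m f g => //= m IH f g; rewrite !IH; field. Qed.

Lemma signavgZ m (c : R) f : signavg m (fun s => c * f s) = c * signavg m f.
Proof. by elim: m f => //= m IH f; rewrite !IH; field. Qed.

Lemma signavg_cstB m (c : R) f : signavg m (fun s => c - f s) = c - signavg m f.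
Proof. by elim: m f => //= m IH f; rewrite !IH; field. Qed.

Lemma signavg_ge0 m f : (forall s, 0 <= f s) -> 0 <= signavg m f.
Proof. by move=> f0; rewrite -(signavg_cst m 0); apply: signavg_le. Qed.

Lemma signavg_opp m f : signavg m (fun s => f (map -%R s)) = signavg m f.
Proof.
elim: m f => //= m IH f.
rewrite (IH (fun s => f (-1 :: s))) opprK (IH (fun s => f (1 :: s))).
by rewrite addrC.
Qed.

Lemma signavg_cat m n f :
  signavg (m + n) f = signavg m (fun s => signavg n (fun t => f (s ++ t))).
Proof. by elim: m f => //= m IH f; rewrite !IH. Qed.

(** Independence of the first [m] signs from the following [n]. *)
Lemma signavg_mul m n f g :
  signavg (m + n) (fun s => f (take m s) * g (drop m s)) = signavg m f * signavg n g.
Proof.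
rewrite signavg_cat mulrC -signavgZ; apply: eq_signavg => s /andP[/eqP sm _].
rewrite mulrC -signavgZ; apply: eq_signavg => t _.
by rewrite -sm take_size_cat// drop_size_cat.
Qed.

End sign_average.

(** * The Rademacher system *)

Section rademacher_average.
Context (R : realType).
Local Notation leb := (@lebesgue_measure R).

Lemma sin_gt0_period (x : R) (j : nat) :
  (2 * j)%:R * pi < x < (2 * j + 1)%:R * pi -> 0 < sin x.
Proof.
move=> /andP[h1 h2].
have -> : x = (x - (2 * j)%:R * pi) + (pi *+ 2) *+ j.
  by rewrite -mulrnA -mulr_natl; ring.
rewrite periodicn; last exact: sinD2pi.
apply: sin_gt0_pi; move: h1 h2; rewrite natrD; lra.
Qed.

Lemma sin_lt0_period (x : R) (j : nat) :
  (2 * j + 1)%:R * pi < x < (2 * j + 2)%:R * pi -> sin x < 0.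
Proof.
move=> /andP[h1 h2]; rewrite -[x](subrK pi) sinDpi oppr_lt0.
by apply: (@sin_gt0_period _ j); move: h1 h2; rewrite !natrD; lra.
Qed.

Lemma rademacher_left (n j : nat) (x : R) :
  (2 * j)%:R / 2 ^+ n < x < (2 * j + 1)%:R / 2 ^+ n -> rademacher n x = 1.
Proof.
have n0 : 0 < 2 ^+ n :> R by rewrite exprn_gt0.
have p0 := pi_gt0 R.
rewrite ltr_pdivrMr// ltr_pdivlMr// => /andP[h1 h2].
rewrite /rademacher gtr0_sg//; apply: (@sin_gt0_period _ j).
by rewrite mulrAC (mulrC (2 ^+ n)) !ltr_pM2r// h1.
Qed.

Lemma rademacher_right (n j : nat) (x : R) :
  (2 * j + 1)%:R / 2 ^+ n < x < (2 * j + 2)%:R / 2 ^+ n -> rademacher n x = -1.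
Proof.
have n0 : 0 < 2 ^+ n :> R by rewrite exprn_gt0.
have p0 := pi_gt0 R.
rewrite ltr_pdivrMr// ltr_pdivlMr// => /andP[h1 h2].
rewrite /rademacher ltr0_sg//; apply: (@sin_lt0_period _ j).
by rewrite mulrAC (mulrC (2 ^+ n)) !ltr_pM2r// h1.
Qed.

(** The values at [x] of the [m] functions [r_n, ..., r_(n + m - 1)]. *)
Definition radseq (n m : nat) (x : R) : seq R := [seq rademacher k x | k <- iota n m].

(** On a dyadic interval of length [2 ^ -n] the functions [r_(n + 1), ...,
    r_(n + m)] take all sign patterns equally often: [r_(n + 1)] has constant
    sign on each half. *)
Lemma rademacher_integral (m n j : nat) (G : seq R -> R) :
  let D : set R := [set` `](j%:R / 2 ^+ n), (j.+1%:R / 2 ^+ n)[] in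
  measurable_fun D (fun x => G (radseq n.+1 m x)) /\
  (\int[leb]_(x in D) (G (radseq n.+1 m x))%:E = ((2 ^+ n)^-1 * signavg m G)%:E)%E.
Proof.
elim: m n j G => [|m IH] n j G; set D := [set` _].
  split; first exact: (measurable_cst (G [::])).
  rewrite (eq_integral (cst (G [::])%:E))// integral_cst//=; last exact: measurable_itv.
  rewrite /D lebesgue_measure_itv/= lte_fin.
  rewrite ltr_pM2r ?invr_gt0 ?exprn_gt0// ltr_nat ltnSn -EFinB -EFinM; congr EFin.
  by rewrite -mulrBl -natr1 addrAC subrr add0r mul1r mulrC.
pose a : R := j%:R / 2 ^+ n; pose c : R := j.+1%:R / 2 ^+ n.
pose b : R := (2 * j + 1)%:R / 2 ^+ n.+1.
have n0 : 0 < 2 ^+ n :> R by rewrite exprn_gt0.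
have aE : (2 * j)%:R / 2 ^+ n.+1 = a.
  by rewrite /a exprS natrM; field; rewrite gt_eqF.
have cE : (2 * j + 2)%:R / 2 ^+ n.+1 = c.
  by rewrite /c exprS natrD natrM -natr1; field; rewrite gt_eqF.
have ab : a < b by rewrite -aE ltr_pM2r ?invr_gt0 ?exprn_gt0// ltr_nat addn1.
have bc : b < c by rewrite -cE ltr_pM2r ?invr_gt0 ?exprn_gt0// ltr_nat ltn_add2l.
have [ml il] := IH n.+1 (2 * j)%N (fun s => G (1 :: s)).
have [mr ir] := IH n.+1 (2 * j + 1)%N (fun s => G (-1 :: s)).
have e1 : (2 * j).+1 = (2 * j + 1)%N by rewrite addn1.
have e2 : (2 * j + 1).+1 = (2 * j + 2)%N by rewrite -addnS.
rewrite e1 aE -/b in ml il.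
rewrite e2 cE -/b in mr ir.
have El x : `]a, b[%classic x -> G (radseq n.+1 m.+1 x) = G (1 :: radseq n.+2 m x).
  by rewrite /= in_itv /= => h; rewrite /radseq /= (@rademacher_left _ j)// aE.
have Er x : `]b, c[%classic x -> G (radseq n.+1 m.+1 x) = G (-1 :: radseq n.+2 m x).
  by rewrite /= in_itv /= => h; rewrite /radseq /= (@rademacher_right _ j)// cE.
have ml' : measurable_fun `]a, b[ (fun x => G (radseq n.+1 m.+1 x)).
  by apply: eq_measurable_fun ml => x; rewrite inE => /El ->.
have mr' : measurable_fun `]b, c[ (fun x => G (radseq n.+1 m.+1 x)).
  by apply: eq_measurable_fun mr => x; rewrite inE => /Er ->.
have mlc : measurable_fun `[a, b[ (fun x => G (radseq n.+1 m.+1 x)).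
  exact/measurable_fun_itv_obnd_cbndP.
have mrc : measurable_fun `[b, c[ (fun x => G (radseq n.+1 m.+1 x)).
  exact/measurable_fun_itv_obnd_cbndP.
have acU : `[a, c[%classic = `[a, b[%classic `|` `[b, c[%classic :> set R.
  by rewrite -itv_bndbnd_setU// bnd_simp ltW.
have mac : measurable_fun `[a, c[ (fun x => G (radseq n.+1 m.+1 x)).
  by rewrite acU; apply/measurable_funU.
have mac' : measurable_fun `]a, c[ (fun x => G (radseq n.+1 m.+1 x)).
  by apply: measurable_funS mac => //; apply: subset_itvr; rewrite bnd_simp.
split => //.
rewrite -(@integral_itv_bndoo _ _ _ _ true true); last exact/measurable_EFinP.
rewrite -/a -/c acU integral_setU//.
- rewrite (@integral_itv_bndoo _ a b _ true true); last exact/measurable_EFinP.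
  rewrite (@integral_itv_bndoo _ b c _ true true); last exact/measurable_EFinP.
  under eq_integral => x.
    rewrite inE => /El ->.
    over.
  rewrite il.
  under eq_integral => x.
    rewrite inE => /Er ->.
    over.
  rewrite ir -EFinD; congr EFin => /=; rewrite exprS; field; rewrite gt_eqF//.
- by rewrite -acU; exact/measurable_EFinP.
- apply/disj_setPS => x; rewrite /= => -[] /=; rewrite !in_itv/= => /andP[_ h1] /andP[h2 _].
  by move: (lt_le_trans h1 h2); rewrite ltxx.
Qed.

Lemma rademacher_integral01 (m : nat) (G : seq R -> R) :
  measurable_fun (`[0%R, 1%R]%classic : set R) (fun x => G (radseq 1 m x)) /\
  (\int[leb]_(x in `[0%R, 1%R]) (G (radseq 1 m x))%:E = (signavg m G)%:E)%E.
Proof.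
have [] := rademacher_integral m 0 0 G.
rewrite expr0 mul0r divr1 invr1 mul1r => mG iG; split; first exact: measurable_fun_itv_cc mG.
by rewrite integral_itv_bndoo//; exact/measurable_EFinP.
Qed.

Lemma measurable_rademacher (n : nat) : measurable_fun setT (@rademacher R n).
Proof.
have msg : measurable_fun setT (@Num.sg R).
  apply: nondecreasing_measurable => // x y xy.
  by rewrite /Num.sg; case: (ltgtP x 0) => hx; case: (ltgtP y 0) => hy //; lra.
apply: (measurableT_comp msg); apply: (measurableT_comp (f := sin)) => //.
  by apply: continuous_measurable_fun; move=> x; exact: continuous_sin.
Qed.

Lemma signavg_prod (m : nat) (f : nat -> R -> R) :
  signavg m (fun s => \prod_(i < m) f i (nth 0 s i)) =
  \prod_(i < m) ((f i 1 + f i (-1)) / 2).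
Proof.
elim: m f => [|m IH] f /=; first by rewrite !big_ord0.
rewrite big_ord_recl /= -(IH (fun i => f i.+1)).
have E x : signavg m (fun s => \prod_(i < m.+1) f i (nth 0 (x :: s) i)) =
    f 0%N x * signavg m (fun s => \prod_(i < m) f i.+1 (nth 0 s i)).
  by rewrite -signavgZ; apply: eq_signavg => s _; rewrite big_ord_recl.
by rewrite !E; field.
Qed.

Local Notation unif := (uniform_prob (@ltr01 R)).

Lemma nth_radseq (m : nat) (i : 'I_m) (x : R) : nth 0 (radseq 1 m x) i = rademacher i.+1 x.
Proof. by rewrite (nth_map 0%N) ?size_iota// nth_iota. Qed.

Lemma unif_rademacher (m : nat) (G : seq R -> R) (f : R -> R) :
  measurable_fun setT f -> (forall x, 0 <= f x) -> (forall x, f x = G (radseq 1 m x)) ->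
  (\int[unif]_x (f x)%:E = (signavg m G)%:E)%E.
Proof.
move=> mf f0 fG; rewrite integral_uniform//.
- rewrite subr0 invr1 mul1e -(rademacher_integral01 m G).2.
  by apply: eq_integral => x _; rewrite fG.
- exact/measurable_EFinP.
Qed.

(** Taking [J] a singleton gives the marginal laws, so that this contains the
    independence of the system. *)
Lemma rademacher_cylinder (m : nat) (J : {set 'I_m}) (B : 'I_m -> set R) :
  (forall i, measurable (B i)) ->
  unif (\bigcap_(i in [set` J]) (@rademacher R i.+1 @^-1` B i)) =
  (\prod_(i in J) ((\1_(B i) 1 + \1_(B i) (-1)) / 2))%:E.
Proof.
move=> mB; set A := \bigcap_(i in _) _.
have mA : measurable A.
  apply: fin_bigcap_measurable => // i _.
  by rewrite -[X in measurable X]setTI; exact: measurable_rademacher.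
pose f (i : nat) (x : R) : R :=
  if insub i is Some k then (if k \in J then \1_(B k) x else 1) else 1.
have fE (k : 'I_m) x : f k x = if k \in J then \1_(B k) x else 1.
  by rewrite /f valK.
transitivity (\int[unif]_x (\1_A x)%:E)%E; first by rewrite integral_indic// setIT.
rewrite (@unif_rademacher m (fun s => \prod_(i < m) f i (nth 0 s i))).
- rewrite signavg_prod [in RHS]big_mkcond /=; congr EFin; apply: eq_bigr => k _.
  by rewrite !fE; case: ifP => // _; field.
- exact: measurable_indic.
- by move=> x; rewrite indicE.
move=> x; under eq_bigr do rewrite nth_radseq fE.
rewrite indicE; case: (asboolP (A x)) => [Ax|nAx].
  rewrite mem_set//= big1// => i _; case: ifP => // iJ.
  by rewrite indicE mem_set//; exact: (Ax i).
rewrite memNset//=; apply/esym/eqP; rewrite prodf_seq_eq0; apply/hasP.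
have [i iJ nB] : exists2 i, i \in J & ~ B i (rademacher i.+1 x).
  apply: contrapT => h; apply: nAx => i iJ; apply: contrapT => nB.
  by apply: h; exists i.
by exists i; rewrite ?mem_index_enum//= iJ indicE memNset.
Qed.

Lemma measurable_rademacher_unif (n : nat) :
  @measurable_fun _ _ (measurableTypeR R) R setT (@rademacher R n).
Proof. exact: measurable_rademacher. Qed.

(** The function [r_(i + 1)] as a random variable on [0, 1]. *)
Definition rademacher_RV (m : nat) (i : 'I_m) : {RV unif >-> R} :=
  MeasurableFun.Pack (MeasurableFun.Class
    (isMeasurableFun.Build _ _ _ _ _ (measurable_rademacher_unif i.+1))).

Lemma rademacher_independent (m : nat) : independent_RVs (@rademacher_RV m).
Proof.
move=> J B mB; apply: etrans (rademacher_cylinder J mB) _.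
rewrite -prodEFin; apply: eq_bigr => i _.
have := rademacher_cylinder [set i]%SET mB; rewrite big_set1 => <-.
congr (unif _); apply/seteqP; split => x /=.
  by move=> /(_ i); apply; rewrite /= inE.
by move=> h j /=; rewrite inE => /eqP ->.
Qed.

Lemma rademacher_le1 n (x : R) : `|rademacher n x| <= 1.
Proof. by rewrite /rademacher normr_sg lern1 leq_b1. Qed.

Lemma rademacher_mean0 (m : nat) (i : 'I_m) : ('E_unif[rademacher_RV i] = 0)%E.
Proof.
rewrite unlock.
have br : bounded_rv (fun t => rademacher_RV i t).
  split; first exact: measurable_rademacher.
  by exists 1 => t; exact: rademacher_le1.
rewrite -EFin_Rexp//; congr EFin.
have : (\int[unif]_t (1 + rademacher_RV i t)%:E = 1)%E.
  rewrite (@unif_rademacher m (fun s => 1 + nth 0 s i)).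
  - rewrite signavgD signavg_cst; congr EFin; rewrite -[RHS]addr0; congr (_ + _).
    have := signavg_prod m (fun j x => if j == i then x else 1).
    rewrite [RHS](bigD1 i)//= eqxx subrr mul0r mul0r => h.
    rewrite -[RHS]h; apply: eq_signavg => s _.
    rewrite (bigD1 i)//= eqxx big1 ?mulr1// => j ji.
    by rewrite (negbTE (_ : (j : nat) != i)).
  - by apply: measurable_funD => //; exact: measurable_rademacher.
  - move=> x; have := rademacher_le1 i.+1 x; rewrite ler_norml => /andP[h _].
    by rewrite -lerBlDl sub0r.
  by move=> x; rewrite nth_radseq.
rewrite -EFin_Rexp; last by apply: bounded_rvD => //; exact: bounded_rv_cst.
rewrite RexpD//; last exact: bounded_rv_cst.
rewrite Rexp_cst => -[] h; lra.
Qed.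

End rademacher_average.

(** * Lower bounds on the V^2 norm from divisions into blocks *)

Section blocks.
Context (R : realType).
Implicit Types (bb : seq (seq R)) (s : seq R).

(** The sum of a sequence. *)
Definition ssum s : R := \sum_(x <- s) x.

Lemma ssum_cat s1 s2 : ssum (s1 ++ s2) = ssum s1 + ssum s2.
Proof. by rewrite /ssum big_cat. Qed.

(** The number of the block of [bb] to which the [n]-th entry of [flatten bb]
    belongs; it is [size bb] beyond the end of [flatten bb]. *)
Fixpoint block_label bb (n : nat) : nat :=
  if bb is x :: bb' then
    if (n < size x)%N then 0%N else (block_label bb' (n - size x)).+1
  else 0%N.

Lemma block_label_le bb n : (block_label bb n <= size bb)%N.
Proof. by elim: bb n => //= x bb IH n; case: ifP => // _; rewrite ltnS. Qed.

Lemma block_label_mono bb : {homo block_label bb : i j / (i <= j)%N}.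
Proof.
elim: bb => //= x bb IH i j ij; case: ltnP => // ix.
have -> : (j < size x)%N = false by apply/negbTE; rewrite -leqNgt (leq_trans ix).
by rewrite ltnS; apply: IH; exact: leq_sub2r.
Qed.

Lemma sum_nth_take s n : (size s <= n)%N -> \sum_(0 <= i < n) nth 0 s i = ssum s.
Proof.
move=> sn; rewrite /ssum [RHS](big_nth 0) (big_cat_nat (n := size s))//=.
rewrite [X in _ + X](_ : _ = 0) ?addr0//.
rewrite big_nat_cond big1// => i /andP[/andP[si _] _].
exact: nth_default.
Qed.

Lemma block_label_sum bb N : (size (flatten bb) <= N)%N -> forall l, (l < size bb)%N ->
  \sum_(0 <= n < N | block_label bb n == l) nth 0 (flatten bb) n = ssum (nth [::] bb l).
Proof.
elim: bb N => //= x bb IH N sN l lb.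
have xN : (size x <= N)%N by move: sN; rewrite size_cat; lia.
rewrite (big_cat_nat (n := size x))//=.
have -> : \sum_(size x <= n < N | (if (n < size x)%N then 0%N else (block_label bb (n - size x)).+1) == l)
    nth 0 (x ++ flatten bb) n =
  \sum_(0 <= n < N - size x | (block_label bb n).+1 == l) nth 0 (flatten bb) n.
  rewrite -{1}[size x]add0n big_addn; apply: eq_big => [i|i _].
    by rewrite addnK ltnNge leq_addl.
  by rewrite nth_cat addnK ltnNge leq_addl.
have -> : \sum_(0 <= n < size x | (if (n < size x)%N then 0%N else (block_label bb (n - size x)).+1) == l)
    nth 0 (x ++ flatten bb) n = if l == 0%N then ssum x else 0.
  transitivity (\sum_(0 <= n < size x | 0%N == l) nth 0 x n).
    rewrite [LHS]big_nat_cond [RHS]big_nat_cond; apply: eq_big => [i|i /andP[/andP[_ ix] _]].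
      by case: ltnP.
    by rewrite nth_cat ix.
  case: l {lb} => [|l] /=; first exact: sum_nth_take.
  by rewrite big_pred0.
case: l lb => [|l] lb /=; first by rewrite big_pred0 ?addr0.
rewrite add0r; under eq_bigl do rewrite eqSS.
by rewrite IH// leq_subRL// -size_cat.
Qed.

(** The entries of [b] beyond the end of [flatten bb] are zero and form one more
    block. *)
Lemma blocks_le_V2norm (N : nat) bb : (size (flatten bb) <= N)%N ->
  \sum_(x <- bb) ssum x ^+ 2 <=
  V2norm (fun i : 'I_N => nth 0 (flatten bb) i) ^+ 2.
Proof.
move=> sN.
have hl (i : 'I_N) : (block_label bb i < (size bb).+1)%N by rewrite ltnS block_label_le.
pose g (i : 'I_N) := Ordinal (hl i).
have [|Q iQ QE] := @label_partition R N _ g.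
  by move=> i j; exact: block_label_mono.
apply: le_trans (V2norm_sq_ge _ iQ); rewrite QE big_ord_recr /= ler_wpDr ?sqr_ge0//.
rewrite (big_nth [::]) big_mkord; apply: ler_sum => l _.
rewrite -(block_label_sum sN (ltn_ord l)).
by rewrite big_mkord le_eqVlt; apply/orP; left; apply/eqP.
Qed.

End blocks.

(** * Anti-concentration of sign sums *)

Section anticoncentration.
Context (R : realType).
Implicit Types (s u v : seq R).

Lemma signavgS m (f : seq R -> R) :
  signavg m.+1 f = signavg m (fun s => 2^-1 * (f (1 :: s) + f (-1 :: s))).
Proof. by rewrite signavgZ signavgD /= mulrC. Qed.

Lemma ssum_cons x s : ssum (x :: s) = x + ssum s.
Proof. by rewrite /ssum big_cons. Qed.

Lemma signavg_sum_sq m : signavg m (fun s => ssum s ^+ 2) = m%:R :> R.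
Proof.
elim: m => [|m IH]; first by rewrite /= /ssum big_nil expr0n.
rewrite signavgS -[RHS]natr1 -IH -[1 in RHS](signavg_cst m 1) -signavgD.
by apply: eq_signavg => s _; rewrite !ssum_cons; field.
Qed.

Lemma signavg_sum_pow4 m : signavg m (fun s => ssum s ^+ 4) <= 3 * m%:R ^+ 2 :> R.
Proof.
elim: m => [|m IH]; first by rewrite /= /ssum big_nil expr0n/= mulr0n expr0n mulr0.
rewrite signavgS.
rewrite (@eq_signavg _ _ _ (fun s => ssum s ^+ 4 + (6 * ssum s ^+ 2 + 1))); last first.
  by move=> s _; rewrite !ssum_cons; field.
rewrite signavgD (signavgD _ (fun s => 6 * ssum s ^+ 2)) signavgZ signavg_sum_sq signavg_cst.
rewrite -[m.+1%:R]natr1; have : 0 <= m%:R :> R by [].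
lra.
Qed.

(** Paley-Zygmund: with [y = S ^ 2 / m], of mean 1 and second moment at most 3,
    the indicator of [y >= 1/4] dominates a multiple of [(y - 1/4) * (6 - y)];
    the sign of [S] costs a factor 2 by symmetry. *)
Lemma large_sum_prob m : (0 < m)%N ->
  10^-1 <= signavg m (fun s => ((0 <= ssum s) && (m%:R <= 4 * ssum s ^+ 2))%:R : R).
Proof.
move=> m0; have mR : 0 < m%:R :> R by rewrite ltr0n.
set f := fun s => _; pose g s : R := (m%:R <= 4 * ssum s ^+ 2 :> R)%:R.
have fg s : g s <= f s + f (map -%R s).
  rewrite /g /f; have -> : ssum [seq - x | x <- s] = - ssum s.
    by rewrite /ssum big_map sumrN.
  rewrite sqrrN oppr_ge0; case: (m%:R <= _) => /=; last by rewrite !andbF addr0.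
  by rewrite !andbT; case: (leP 0 (ssum s)) => /= h; [|rewrite (ltW h)]; rewrite ?lerDl ?lerDr ?ler0n ?add0r.
have : signavg m g <= 2 * signavg m f.
  apply: le_trans (signavg_le (fun s _ => fg s)) _.
  by rewrite signavgD signavg_opp; lra.
(* The maximum of [(y - 1/4) * (6 - y)] is [529 / 64], attained at [25 / 8]. *)
have : signavg m (fun s => (64 / 529) * ((ssum s ^+ 2 / m%:R - 4^-1) * (6 - ssum s ^+ 2 / m%:R)))
    <= signavg m g.
  apply: signavg_le => s _; rewrite /g; set y := ssum s ^+ 2 / m%:R.
  have -> : (m%:R <= 4 * ssum s ^+ 2) = (4^-1 <= y).
    by rewrite /y ler_pdivlMr//; apply/idP/idP; lra.
  have := sqr_ge0 (y - 25 / 8); case: (leP 4^-1 y) => h /=; first lra.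
  (* Here the left-hand side is nonpositive. *)
  have : 0 <= (4^-1 - y) * (6 - y) by apply: mulr_ge0; lra.
  lra.
rewrite signavgZ.
rewrite (@eq_signavg _ _ _ (fun s => (25 / 4 / m%:R) * ssum s ^+ 2 + (- (m%:R ^+ 2)^-1 * ssum s ^+ 4 + - (3 / 2)))); last first.
  by move=> s _; field; rewrite gt_eqF.
rewrite signavgD (signavgD _ (fun s => - (m%:R ^+ 2)^-1 * ssum s ^+ 4)) !signavgZ signavg_sum_sq signavg_cst.
have h4 : (m%:R ^+ 2)^-1 * signavg m (fun s => ssum s ^+ 4) <= 3 :> R.
  by rewrite ler_pdivrMl ?exprn_gt0// mulrC signavg_sum_pow4.
rewrite divfK ?gt_eqF//; lra.
Qed.

(** The indicator of [b]. *)
Definition boolR (b : bool) : R := b%:R.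

(** A lower bound for the probability that a sum of [2 ^ (k + j)] signs is at
    least [2 ^ (j / 2) / 2] times its standard deviation: it suffices that each of [2 ^ j] sub-blocks of length
    [2 ^ k] has a nonnegative sum of at least half its standard deviation. *)
Lemma deviation_prob (k j : nat) :
  10^-1 ^+ (2 ^ j) <=
  signavg (2 ^ (k + j)) (fun s => boolR ((0 <= ssum s) && (4 ^+ j * 2 ^+ k <= 4 * ssum s ^+ 2))).
Proof.
elim: j => [|j IH].
  rewrite addn0 expn0 expr1; have k0 : (0 < 2 ^ k)%N by rewrite expn_gt0.
  apply: le_trans (large_sum_prob k0) _.
  by apply: signavg_le => s _; rewrite natrX expr0 mul1r.
pose h := fun s => boolR ((0 <= ssum s) && (4 ^+ j * 2 ^+ k <= 4 * ssum s ^+ 2)).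
have E : (2 ^ (k + j.+1) = 2 ^ (k + j) + 2 ^ (k + j))%N by rewrite addnS expnS; lia.
have E' : (2 ^ j.+1 = 2 ^ j + 2 ^ j)%N by rewrite expnS; lia.
rewrite E' exprD E.
apply: (@le_trans _ _ (signavg (2 ^ (k + j) + 2 ^ (k + j))
   (fun s => h (take (2 ^ (k + j)) s) * h (drop (2 ^ (k + j)) s)))).
  rewrite signavg_mul; apply: ler_pM => //; apply: exprn_ge0; lra.
apply: signavg_le => s _; rewrite -{3 4}(cat_take_drop (2 ^ (k + j)) s) ssum_cat.
set x := ssum (take _ s); set y := ssum (drop _ s).
rewrite /h -/x -/y /boolR; set q := 4 ^+ j * 2 ^+ k.
have q0 : 0 <= q by rewrite mulr_ge0 ?exprn_ge0.
have -> : 4 ^+ j.+1 * 2 ^+ k = 4 * q by rewrite exprS mulrA.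
case: (boolP ((0 <= x) && _)) => /= [/andP[x0 hx]|_]; last by rewrite mul0r ler0n.
case: (boolP ((0 <= y) && _)) => /= [/andP[y0 hy]|_]; last by rewrite mulr0 ler0n.
rewrite addr_ge0//= mulr1.
have hxy : q <= 4 * (x * y).
  rewrite -(@ler_pXn2r _ 2)// ?nnegrE ?mulr_ge0//.
  have : q * q <= (4 * x ^+ 2) * (4 * y ^+ 2) by apply: ler_pM.
  lra.
have -> : 4 * q <= 4 * (x + y) ^+ 2 by lra.
by [].
Qed.

End anticoncentration.

(** * Covering by dyadic intervals with a good half *)

Section covering.
Context (R : realType) (j : nat).
Implicit Types (s u v : seq R).

(** A block of length [2 ^ k] whose squared sum is at least [2 ^ j / 4] times its
    length. For [k < j] no block is called good, since [deviation_prob] needs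
    [2 ^ j] sub-blocks. *)
Definition goodblock (k : nat) s : bool :=
  (j <= k)%N && (2 ^+ j * 2 ^+ k <= 4 * ssum s ^+ 2).

(** The number of entries of a sequence of length [2 ^ k] that lie in no dyadic
    interval having a good half. *)
Fixpoint uncovered (k : nat) s : R :=
  if k is k'.+1 then
    let u := take (2 ^ k') s in let v := drop (2 ^ k') s in
    if goodblock k' u || goodblock k' v then 0
    else uncovered k' u + uncovered k' v
  else 1.

Lemma uncovered_ge0 k s : 0 <= uncovered k s.
Proof. by elim: k s => //= k IH s; case: ifP => // _; rewrite addr_ge0. Qed.

Lemma uncovered_le k s : uncovered k s <= 2 ^+ k.
Proof.
elim: k s => [|k IH] s /=; first by rewrite expr0.
case: ifP => _; first by rewrite exprn_ge0.
by rewrite exprS mulr_natl mulr2n lerD.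
Qed.

(** Cut the maximal dyadic intervals with a good half at their midpoints. *)
Lemma covering_blocks k s : size s = (2 ^ k)%N ->
  exists2 bb, flatten bb = s &
    2 ^+ j / 8 * (2 ^+ k - uncovered k s) <= \sum_(x <- bb) ssum x ^+ 2.
Proof.
have j0 : 0 < 2 ^+ j :> R by rewrite exprn_gt0.
elim: k s => [|k IH] s sk.
  exists [:: s]; first by rewrite /= cats0.
  by rewrite /= expr0 subrr mulr0 big_seq1 sqr_ge0.
have su : size (take (2 ^ k) s) = (2 ^ k)%N.
  by rewrite size_takel// sk expnS; lia.
have sv : size (drop (2 ^ k) s) = (2 ^ k)%N.
  by rewrite size_drop sk expnS; lia.
rewrite [uncovered _ _]/=; case: ifPn => [gd|_].
  exists [:: take (2 ^ k) s; drop (2 ^ k) s]; first by rewrite /= cats0 cat_take_drop.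
  rewrite big_cons big_seq1 subr0 exprS.
  have := sqr_ge0 (ssum (take (2 ^ k) s)); have := sqr_ge0 (ssum (drop (2 ^ k) s)).
  by case/orP : gd => /andP[_]; lra.
have [bu fu hu] := IH _ su; have [bv fv hv] := IH _ sv.
exists (bu ++ bv); first by rewrite flatten_cat fu fv cat_take_drop.
rewrite big_cat exprS /=; lra.
Qed.

(** An entry of the first half is uncovered only if it is uncovered within that
    half and the second half is not good; these two events are independent. *)
Lemma uncovered_avgS k : signavg (2 ^ k.+1) (uncovered k.+1) <=
  2 * ((1 - signavg (2 ^ k) (fun s => boolR R (goodblock k s)))
    * signavg (2 ^ k) (uncovered k)).
Proof.
have -> : (2 ^ k.+1 = 2 ^ k + 2 ^ k)%N by rewrite expnS; lia.
pose h s := 1 - boolR R (goodblock k s).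
have hE : signavg (2 ^ k) h = 1 - signavg (2 ^ k) (fun s => boolR R (goodblock k s)).
  exact: signavg_cstB.
rewrite -hE.
apply: (@le_trans _ _ (signavg (2 ^ k + 2 ^ k) (fun s =>
  uncovered k (take (2 ^ k) s) * h (drop (2 ^ k) s) +
  h (take (2 ^ k) s) * uncovered k (drop (2 ^ k) s)))).
  apply: signavg_le => s _; rewrite [uncovered _ _]/= /h /boolR.
  have := uncovered_ge0 k (take (2 ^ k) s); have := uncovered_ge0 k (drop (2 ^ k) s).
  by case: (goodblock k (take _ _)); case: (goodblock k (drop _ _)) => /= ? ?; lra.
rewrite signavgD (signavg_mul _ _ (uncovered k)) (signavg_mul _ _ h); lra.
Qed.

Lemma uncovered_avg n : signavg (2 ^ (j + n)) (uncovered (j + n)) <=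
  2 ^+ (j + n) * (1 - 10^-1 ^+ (2 ^ j)) ^+ n.
Proof.
set p := 10^-1 ^+ _.
have p1 : 0 <= 1 - p by rewrite subr_ge0 exprn_ile1//; lra.
elim: n => [|n IH].
  rewrite addn0 expr0 mulr1 -[leRHS](signavg_cst (2 ^ j)).
  by apply: signavg_le => s _; exact: uncovered_le.
rewrite addnS; apply: le_trans (uncovered_avgS _) _.
have hp : p <= signavg (2 ^ (j + n)) (fun s => boolR R (goodblock (j + n) s)).
  rewrite addnC; apply: le_trans (deviation_prob _ n j) _.
  apply: signavg_le => s _; rewrite /goodblock leq_addl /boolR /=.
  have -> : 2 ^+ j * 2 ^+ (n + j) = 4 ^+ j * 2 ^+ n :> R.
    by rewrite exprD mulrCA mulrC -exprMn -natrM.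
  by rewrite ler_nat; case: (_ <= ssum s); case: (_ <= _).
rewrite !exprS -!mulrA ler_pM2l// [leRHS]mulrCA.
apply: ler_pM => //.
- by rewrite subr_ge0 -[leRHS](signavg_cst (2 ^ (j + n)) 1); apply: signavg_le => s _; rewrite /boolR lern1 leq_b1.
- by apply: signavg_ge0 => s; exact: uncovered_ge0.
by rewrite lerD2l lerN2.
Qed.

Lemma uncovered_avg_half : signavg (2 ^ (j + 10 ^ (2 ^ j))) (uncovered (j + 10 ^ (2 ^ j)))
  <= 2 ^+ (j + 10 ^ (2 ^ j)) / 2.
Proof.
set n := (10 ^ (2 ^ j))%N.
apply: le_trans (uncovered_avg n) _.
rewrite ler_pM2l ?exprn_gt0//.
set p := 10^-1 ^+ _.
have p0 : 0 < p by rewrite exprn_gt0// invr_gt0.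
have p1 : p <= 1 by rewrite exprn_ile1//; lra.
(* [n] independent chances of probability [p = 1 / n], and Bernoulli's
   inequality. *)
have np : n%:R * p = 1 by rewrite /n /p natrX exprVn mulfV// expf_neq0.
have bern m : 1 + m%:R * p <= (1 + p) ^+ m.
  elim: m => [|m IH]; first by rewrite mul0r addr0 expr0.
  rewrite exprS; apply: (@le_trans _ _ ((1 + p) * (1 + m%:R * p))).
    have : 0 <= m%:R * (p * p) by apply: mulr_ge0 => //; apply: mulr_ge0; exact: ltW.
    by rewrite -[m.+1%:R]natr1; lra.
  by rewrite ler_pM2l//; lra.
have h2 : 2 <= (1 + p) ^+ n by apply: le_trans (bern n); rewrite np.
have : (1 - p) ^+ n * (1 + p) ^+ n <= 1.
  rewrite -exprMn exprn_ile1//; first nra.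
  by nra.
have : 0 <= (1 - p) ^+ n by rewrite exprn_ge0// subr_ge0.
nra.
Qed.

End covering.

(** * The lower bound *)

Section rademacher_lower.
Context (R : realType).
Local Notation leb := (@lebesgue_measure R).

Lemma measurable_V2norm_rademacher (N : nat) (a : 'I_N -> R) :
  measurable_fun setT (fun x => V2norm (fun n : 'I_N => a n * rademacher n.+1 x) ^+ 2).
Proof.
apply: measurable_V2norm_sq => i; apply: measurable_funM => //.
exact: measurable_rademacher.
Qed.

Lemma V2_lower_of_signavg (N m : nat) (a : 'I_N -> R) (G : seq R -> R) :
  (forall s, 0 <= G s) ->
  (forall x, G (radseq 1 m x) <= V2norm (fun n : 'I_N => a n * rademacher n.+1 x) ^+ 2) ->
  ((signavg m G)%:E <= \int[leb]_(x in `[0%R, 1%R])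
    (V2norm (fun n : 'I_N => a n * rademacher n.+1 x) ^+ 2)%:E)%E.
Proof.
move=> G0 GV; have [mG <-] := rademacher_integral01 m G.
apply: ge0_le_integral => //.
- by move=> x _; rewrite lee_fin.
- exact/measurable_EFinP.
- apply/measurable_EFinP; apply: measurable_funS (measurable_V2norm_rademacher a) => //.
by move=> x _; rewrite lee_fin.
Qed.

(** A single nonzero coefficient, for small [N]. *)
Lemma rademacher_lower_trivial (N : nat) : (0 < N)%N ->
  exists2 a : 'I_N -> R, exists n, a n != 0 &
  ((\sum_n a n ^+ 2)%:E <= \int[leb]_(x in `[0%R, 1%R])
    (V2norm (fun n : 'I_N => a n * rademacher n.+1 x) ^+ 2)%:E)%E.
Proof.
case: N => // N _; exists (fun n => (n == ord0)%:R).
  by exists ord0; rewrite /= ?eqxx oner_neq0.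
have -> : \sum_(n < N.+1) ((n == ord0)%:R : R) ^+ 2 = signavg 1 (fun s => ssum s ^+ 2).
  rewrite signavg_sum_sq (bigD1 ord0)//= ?eqxx expr1n big1 ?addr0// => i /negbTE ->.
  by rewrite expr0n.
apply: V2_lower_of_signavg => [s|x]; first exact: sqr_ge0.
have := @blocks_le_V2norm R N.+1 [:: [:: rademacher 1 x]] isT.
rewrite big_seq1 /ssum /= => /le_trans; apply.
rewrite le_eqVlt; apply/orP; left; apply/eqP; congr (V2norm _ ^+ 2).
apply/funext => -[[|i] hi] /=; first by rewrite mul1r.
by rewrite mul0r nth_nil.
Qed.

Lemma rademacher_lower_block (N j : nat) : (2 ^ (j + 10 ^ (2 ^ j)) <= N)%N ->
  exists2 a : 'I_N -> R, exists n, a n != 0 &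
  ((2 ^+ j / 16 * \sum_n a n ^+ 2)%:E <= \int[leb]_(x in `[0%R, 1%R])
    (V2norm (fun n : 'I_N => a n * rademacher n.+1 x) ^+ 2)%:E)%E.
Proof.
have half := @uncovered_avg_half R j.
move: (j + _)%N half => K half KN.
(* From here on [K] is any exponent for which half of the entries are covered. *)
exists (fun n => (n < 2 ^ K)%N%:R).
  have K0 : (0 < 2 ^ K)%N by rewrite expn_gt0.
  by exists (Ordinal (leq_trans K0 KN)); rewrite /= K0 oner_neq0.
have -> : \sum_(n < N) (((n < 2 ^ K)%N%:R : R) ^+ 2) = 2 ^+ K.
  rewrite (eq_bigr (fun n : 'I_N => if (n < 2 ^ K)%N then 1 else 0 : R)); last first.
    by move=> n _; case: ifP; rewrite ?expr1n ?expr0n.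
  by rewrite -big_mkcond -(big_ord_widen N (fun=> 1 : R) KN) sumr_const card_ord natrX.
pose G (s : seq R) := 2 ^+ j / 8 * (2 ^+ K - uncovered j K s).
apply: (@le_trans _ _ (signavg (2 ^ K) G)%:E).
  rewrite lee_fin /G signavgZ.
  have -> : signavg (2 ^ K) (fun s : seq R => 2 ^+ K - uncovered j K s) =
      2 ^+ K - signavg (2 ^ K) (uncovered j K).
    exact: signavg_cstB.
  have -> : 2 ^+ j / 16 * 2 ^+ K = 2 ^+ j / 8 * (2 ^+ K - 2 ^+ K / 2) :> R by field.
  by rewrite ler_wpM2l ?lerD2l ?lerN2// divr_ge0 ?exprn_ge0.
apply: V2_lower_of_signavg => [s|x].
  by rewrite /G mulr_ge0 ?divr_ge0 ?exprn_ge0// subr_ge0 uncovered_le.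
have sx : size (radseq 1 (2 ^ K) x) = (2 ^ K)%N by rewrite size_map size_iota.
have [bb bbE hb] := covering_blocks j sx.
apply: le_trans hb _.
have sN : (size (flatten bb) <= N)%N by rewrite bbE sx.
apply: le_trans (blocks_le_V2norm sN) _.
rewrite le_eqVlt; apply/orP; left; apply/eqP; congr (V2norm _ ^+ 2).
apply/funext => i; rewrite bbE; case: ltnP => iK; last first.
  by rewrite mul0r nth_default// sx.
by rewrite mul1r (nth_radseq (Ordinal iK)).
Qed.

(** The first case covers [N < 2 ^ 10]; otherwise [j] is the largest integer
    for which [rademacher_lower_block] applies. *)
Lemma lnln_scale (N : nat) : (3 <= N)%N ->
  ln (ln N%:R) <= 640 :> R \/
  exists j, (2 ^ (j + 10 ^ (2 ^ j)) <= N)%N /\ ln (ln N%:R) <= 40 * 2 ^+ j :> R.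
Proof.
move=> N3.
have lN := ln_ge1 R N3.
have lnN0 : 0 < ln N%:R :> R by apply: lt_le_trans lN.
have key e : (N <= 2 ^ (10 ^ e))%N -> ln (ln N%:R) <= 10 * e%:R :> R.
  move=> Ne.
  have ln2 : ln 2 <= 1 :> R.
    rewrite -[leRHS]expRK ler_ln ?posrE ?expR_gt0//.
    by have := @expR_ge1Dx R 1; lra.
  have ln10 : ln 10 <= 10 :> R by apply/ltW/ln_sublinear.
  have h1 : ln N%:R <= 10 ^+ e :> R.
    apply: (@le_trans _ _ (ln ((2 ^ (10 ^ e))%N%:R))).
      by rewrite ler_ln ?posrE ?ler_nat ?ltr0n ?expn_gt0//; lia.
    rewrite natrX lnXn// -[ln _ *+ _]mulr_natr natrX.
    by rewrite ler_piMl// exprn_ge0.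
  apply: (@le_trans _ _ (ln (10 ^+ e))).
    by rewrite ler_ln ?posrE ?exprn_gt0//.
  by rewrite lnXn// -[ln _ *+ _]mulr_natr ler_wpM2r.
have [h0|h0] := leqP (2 ^ (0 + 10 ^ (2 ^ 0))) N; last first.
  left; apply: (@le_trans _ _ (10 * 1%:R)); last by lra.
  by apply: key; apply: ltnW; move: h0; rewrite add0n expn0.
right.
have jN k : (2 ^ (k + 10 ^ (2 ^ k)) <= N)%N -> (k <= N)%N.
  move=> h; apply: ltnW; apply: leq_trans (ltn_expl k (ltnSn 1)) (leq_trans _ h).
  by rewrite leq_exp2l// leq_addr.
have [j hj jmax] := ex_maxnP (ex_intro (fun k => (2 ^ (k + 10 ^ (2 ^ k)) <= N)%N) 0%N h0) jN.
exists j; split => //.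
have Nj : (N < 2 ^ (j.+1 + 10 ^ (2 ^ j.+1)))%N.
  by rewrite ltnNge; apply/negP => /jmax; rewrite ltnn.
apply: (@le_trans _ _ (10 * (2 ^ j.+2)%N%:R)); last first.
  by rewrite natrX !exprS; lra.
apply: key; apply: leq_trans (ltnW Nj) _; rewrite leq_exp2l//.
have h2 : (j.+1 <= 10 ^ (2 ^ j.+1))%N.
  apply: leq_trans (ltnW (ltn_expl _ (ltnSn 1))) _.
  exact/ltnW/ltn_expl.
rewrite [(2 ^ j.+2)%N]expnS mul2n -addnn expnD.
have h3 : (2 <= 10 ^ (2 ^ j.+1))%N by rewrite (@leq_trans (10 ^ 1))// leq_exp2l// expn_gt0.
have : (10 ^ (2 ^ j.+1) * 2 <= 10 ^ (2 ^ j.+1) * 10 ^ (2 ^ j.+1))%N by rewrite leq_mul2l h3 orbT.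
lia.
Qed.

Lemma rademacher_lower : exists2 q : R, 0 < q & forall N : nat, (3 <= N)%N ->
  exists2 a : 'I_N -> R, exists n, a n != 0 &
  ((q * ln (ln N%:R) * \sum_n a n ^+ 2)%:E <= \int[leb]_(x in `[0%R, 1%R])
    (V2norm (fun n : 'I_N => a n * rademacher n.+1 x) ^+ 2)%:E)%E.
Proof.
exists 640^-1; first by lra.
move=> N N3; have N0 : (0 < N)%N by exact: leq_trans N3.
case: (lnln_scale N3) => [h|[j [jN h]]].
  have [a a0 ha] := rademacher_lower_trivial N0.
  exists a; first exact: a0.
  apply: le_trans ha; rewrite lee_fin -[leRHS]mul1r; apply: ler_wpM2r; last by lra.
  by apply: sumr_ge0 => i _; exact: sqr_ge0.
have [a a0 ha] := rademacher_lower_block jN.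
exists a; first exact: a0.
apply: le_trans ha; rewrite lee_fin; apply: ler_wpM2r; last by lra.
by apply: sumr_ge0 => i _; exact: sqr_ge0.
Qed.

End rademacher_lower.

Theorem theorem9 (R : realType) :
  (forall C : R, 0 < C ->
    exists K : R, 0 < K /\
      forall (N : nat), (3 <= N)%N ->
      forall (d : measure_display) (T : measurableType d) (P : probability T R)
        (X : 'I_N -> {RV P >-> R}) (a : 'I_N -> R),
        independent_RVs X ->
        (forall i, 'E_P[X i] = 0)%E ->
        (forall i, {ae P, forall t, `|X i t| <= C}) ->
        (forall i, 'E_P[fun t => (`|X i t| ^+ 2)%R] = 1)%E ->
        (sqrte 'E_P[fun t => (V2norm (fun i => (a i * X i t)%R) ^+ 2)%R]
         <= (K * Num.sqrt (ln (ln N%:R)) * Num.sqrt (\sum_(i < N) a i ^+ 2))%:E)%E)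
  /\
  (exists c c' : R, [/\ 0 < c, c < c' &
    forall N : nat, (3 <= N)%N ->
      let S : \bar R :=
        ereal_sup [set (rademacher_V2_L2 a
                        / (Num.sqrt (\sum_(n < N) a n ^+ 2))%:E)%E
                  | a in [set a : 'I_N -> R | exists n, a n != 0]] in
      ((c * Num.sqrt (ln (ln N%:R)))%:E <= S
         <= (c' * Num.sqrt (ln (ln N%:R)))%:E)%E]).
Proof.
split.
  move=> C /V2_upper_constant[K [K0 hK]]; exists K; split => //.
  by move=> N N3 d T P X a indX X0 XC _; exact: hK.
have [K [K0 hK]] := V2_upper_constant (@ltr01 R).
have [q q0 hq] := rademacher_lower R.
exists (Num.sqrt q), (Num.sqrt q + K); split.
- by rewrite sqrtr_gt0.
- by rewrite ltrDl.
move=> N N3; set S := ereal_sup _; cbv zeta.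
have N0 : (0 < N)%N by exact: leq_trans N3.
have L0 : 0 <= ln (ln N%:R) :> R.
  by apply: ltW; apply: lt_le_trans (lnln3_gt0 R) (lnln_ge3 R N3).
have asum (a : 'I_N -> R) : (exists n, a n != 0) -> 0 < \sum_(n < N) a n ^+ 2.
  move=> [n an]; rewrite (bigD1 n)//= ltr_pwDl//.
    by rewrite exprn_even_gt0.
  by apply: sumr_ge0 => i _; exact: sqr_ge0.
apply/andP; split.
  have [a a0 ha] := hq N N3.
  have sa := asum a a0.
  apply: (@le_trans _ _ (rademacher_V2_L2 a / (Num.sqrt (\sum_(n < N) a n ^+ 2))%:E)%E); last first.
    by apply: ereal_sup_ubound; exists a.
  rewrite inver gt_eqF ?sqrtr_gt0// lee_pdivlMr ?sqrtr_gt0// -EFinM -sqrtrM; last exact: ltW.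
  rewrite -sqrtrM; last by rewrite mulr_ge0// ltW.
  apply: (@le_trans _ _ (sqrte (q * ln (ln N%:R) * \sum_(n < N) a n ^+ 2)%:E)) => //.
  rewrite /rademacher_V2_L2 lee_sqrt//.
  by apply: integral_ge0 => x _; rewrite lee_fin sqr_ge0.
apply: ge_ereal_sup => _ [a a0 <-].
have sa := asum a a0.
rewrite inver gt_eqF ?sqrtr_gt0// lee_pdivrMr ?sqrtr_gt0// -EFinM.
have := hK N N3 _ _ _ (@rademacher_RV R N) a (@rademacher_independent R N)
  (@rademacher_mean0 R N) _.
rewrite unlock integral_uniform; last 2 first.
- apply/measurable_EFinP; exact: measurable_V2norm_rademacher.
- by move=> x; rewrite lee_fin sqr_ge0.
rewrite subr0 invr1 mul1e => h.
apply: le_trans (h _) _.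
  by move=> i; apply: aeW => t; exact: rademacher_le1.
rewrite lee_fin ler_wpM2r ?sqrtr_ge0// ler_wpM2r ?sqrtr_ge0//.
by rewrite lerDr sqrtr_ge0.
Qed.
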